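(* Let $\pi\in S_n$ be a permutation of type $(k,n)$ defining a loopless positroid $\mathcal M_\pi$ whose connected components have ground sets $S_1,\dots,S_c$, with $n_j=|S_j|$. Let $G^\rho$ be admissible (that is, $\rho$ is admissible for $\pi$ and $G$ is a reduced plabic graph with trip permutation $\mu=\rho^{-1}\pi\rho$), and set $A_j=\rho^{-1}(S_j)$ for $1\le j\le c$. Then $A_1,\dots,A_c$ are precisely the ground sets of the connected components of $\mathcal M_\mu$. Equip $A_j$ and $S_j$ with their inherited cyclic orders. There exist cyclic order-preserving bijections $\alpha_j:[n_j]\xrightarrow{\sim}A_j$ and $\beta_j:[n_j]\xrightarrow{\sim}S_j$ such that the induced permutations $$\mu_j=\alpha_j^{-1}\mu\alpha_j,\qquad\pi_j=\beta_j^{-1}\pi\beta_j,\qquad\rho_j=\beta_j^{-1}\rho\alpha_j$$ satisfy $\pi_j=\rho_j\mu_j\rho_j^{-1}$, and $\rho_j$ is admissible for $\pi_j$ whenever $n_j>1$. If $n_j=1$, all three permutations are the identity, and the corresponding component is a singleton coloop.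
   Context: Permutations compose right to left; all fixed points are coloured white. The bounded affine lift of $\sigma\in S_N$ is the bijection $f_\sigma:\mathbb Z\to\mathbb Z$ with $f_\sigma(a+N)=f_\sigma(a)+N$, $f_\sigma(a)\equiv\sigma(a)$ mod $N$, $a<f_\sigma(a)\le a+N$; $\sigma$ has type $(k,N)$ if $\frac1N\sum_{a=1}^N(f_\sigma(a)-a)=k$. Let $<_a$ be the cyclic order on $[N]$ starting at $a$, and $\le_a$ the induced elementwise order on $k$-subsets. For $\sigma$ of type $(k,N)$: $I_a^\sigma=\{j:j\le_a\sigma^{-1}(j)\}$, and the (loopless) positroid is $\mathcal M_\sigma=\{J\in\binom{[N]}k:I_a^\sigma\le_aJ\ \forall a\}$ (its bases). A matroid is connected if it is not a direct sum on two nonempty disjoint ground sets; every matroid decomposes uniquely as a direct sum of connected components. The permutation $\pi$ preserves each $S_j$. For an affine permutation $f$ of period $N$, $\ell(f)=\#\{(a,b)\in[N]\times\mathbb Z:a<b,\ f(a)>f(b)\}$. For affine permutations of the same average displacement, $u\le_Rf$ iff $\ell(f)=\ell(u)+\ell(u^{-1}f)$; for $\iota,\pi$ of type $(k,N)$, $\iota\le_\circ\pi$ iff $f_\iota\le_Rf_\pi$. $\rho\in S_N$ is admissible for $\pi$ of type $(k,N)$ if $\pi\rho$ has type $(k,N)$, $\pi\rho\le_\circ\pi$, and $\dim\widehat\Pi_\mu^\circ=\dim\widehat\Pi_\pi^\circ$ for $\mu=\rho^{-1}\pi\rho$, where $\dim\widehat\Pi^\circ_\sigma=k(N-k)+1-\ell(f_\sigma)$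 is the dimension of the affine cone over the open positroid variety; equivalently $\ell(f_\mu)=\ell(f_\pi)$. *)

(* Defs.v *)
From HB Require Import structures.
From mathcomp Require Import finmap classical_sets cardinality.
From mathcomp Require Import all_boot all_order all_algebra all_fingroup.
From mathcomp Require Import zify.

Set Implicit Arguments.
Unset Strict Implicit.
Unset Printing Implicit Defensive.

Import Order.TTheory GRing.Theory Num.Theory.
Local Open Scope ring_scope.
Local Open Scope set_scope.

(** Throughout, [N] = {1, ..., N} is represented by ['I_N], each residue mod N
    being represented in {0, ..., N - 1}; all notions below are invariant under
    translation of the labels. *)

(** The group law of ['S_N] composes from left to right; [s \oS t] is the
    right-to-left composite [x |-> s (t x)]. *)
Definition perm_comp (N : nat) (s t : 'S_N) : 'S_N := (t * s)%g.
Notation "s \oS t" := (perm_comp s t) (at level 50, left associativity).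

(** * Affine permutations *)

Record affine_perm (N : nat) := AffinePerm {
  aff_fun :> int -> int;
  aff_inv : int -> int;
  aff_funK : cancel aff_fun aff_inv;
  aff_invK : cancel aff_inv aff_fun;
  aff_funD : forall a : int, aff_fun (a + N%:Z) = aff_fun a + N%:Z
}.

(** The number of pairs (a, b) in {1, ..., N} x Z with a < b and f a > f b.
    This set is finite when f is an affine permutation ([fset_set] of an
    infinite set would be empty). *)
Definition aff_length (N : nat) (f : int -> int) : nat :=
  #|` fset_set [set p : int * int |
        [/\ 1 <= p.1 <= N%:Z, p.1 < p.2 & f p.2 < f p.1]]%classic |%fset.

Definition avg_displacement (N : nat) (f : int -> int) : rat :=
  (\sum_(1 <= a < N.+1) (f a%:Z - a%:Z))%:~R / N%:R.

Definition le_R (N : nat) (u f : affine_perm N) : Prop :=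
  avg_displacement N u = avg_displacement N f /\
  aff_length N f = (aff_length N u + aff_length N (aff_inv u \o f))%N.

(** * The bounded affine lift *)

(** The representative in {1, ..., N} of [s i - i] mod N. *)
Definition lift_gap (N : nat) (s : 'S_N) (i : 'I_N) : nat :=
  if (i < s i)%N then (s i - i)%N else (s i + N - i)%N.

Definition residue (N : nat) (a : int) : option 'I_N := insub `|(a %% N%:Z)%Z|%N.

Definition lift_fun (N : nat) (s : 'S_N) (a : int) : int :=
  if residue N a is Some i then a + (lift_gap s i)%:Z else a.

Definition lift_inv (N : nat) (s : 'S_N) (b : int) : int :=
  if residue N b is Some i then b - (lift_gap s ((s^-1)%g i))%:Z else b.

Section BoundedLift.
Variables (N : nat) (s : 'S_N).

Lemma residueP (a : int) (i : 'I_N) :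
  residue N a = Some i <-> (a = i%:Z %[mod N%:Z])%Z.
Proof.
have Ngt0 : (0 < N)%N by apply: leq_ltn_trans (ltn_ord i).
have iE : (i%:Z %% N%:Z)%Z = i%:Z by rewrite modz_small //= ltz_nat ltn_ord.
have a_ge0 : 0 <= (a %% N%:Z)%Z by rewrite modz_ge0 // eqz_nat -lt0n.
rewrite /residue iE; case: insubP => [j _ jE | ].
  split => [[<-]|aE]; first by rewrite jE gez0_abs.
  by congr Some; apply: val_inj; rewrite /= jE aE.
move=> h; split => // aE; case/negP: h.
by rewrite aE absz_nat ltn_ord.
Qed.

Lemma residue_exists (a : int) : (0 < N)%N -> exists i, residue N a = Some i.
Proof.
move=> Ngt0; have lt : (`|(a %% N%:Z)%Z| < N)%N.
  rewrite -ltz_nat gez0_abs ?ltz_pmod // modz_ge0 // eqz_nat -lt0n //.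
by exists (Ordinal lt); apply/residueP; rewrite /= gez0_abs ?modz_mod // modz_ge0 // eqz_nat -lt0n.
Qed.

Lemma lift_gap_bounds (i : 'I_N) : (0 < lift_gap s i <= N)%N.
Proof. by rewrite /lift_gap; have := ltn_ord i; have := ltn_ord (s i); case: ifP; lia. Qed.

Lemma lift_gap_mod (i : 'I_N) : (i%:Z + (lift_gap s i)%:Z = (s i)%:Z %[mod N%:Z])%Z.
Proof.
rewrite /lift_gap; case: ifP => h; first by congr modz; lia.
have -> : i%:Z + (s i + N - i)%N%:Z = (s i)%:Z + N%:Z by have := ltn_ord i; lia.
by rewrite modzDr.
Qed.

Lemma residueD (a : int) : residue N (a + N%:Z) = residue N a.
Proof. by rewrite /residue modzDr. Qed.

Lemma residue_lift (a : int) (i : 'I_N) :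
  residue N a = Some i -> residue N (lift_fun s a) = Some (s i).
Proof.
move=> ai; rewrite /lift_fun ai; apply/residueP; rewrite -lift_gap_mod.
by move/residueP: ai => ai; rewrite -modzDml ai modzDml.
Qed.

Lemma residue_lift_inv (b : int) (i : 'I_N) :
  residue N b = Some i -> residue N (lift_inv s b) = Some ((s^-1)%g i).
Proof.
move=> bi; rewrite /lift_inv bi; apply/residueP; move/residueP: bi.
have [j ->] : exists j, i = s j by exists ((s^-1)%g i); rewrite permKV.
rewrite permK => bi; rewrite -modzDml bi -lift_gap_mod modzDml; congr modz; lia.
Qed.

Lemma lift_funD (a : int) : lift_fun s (a + N%:Z) = lift_fun s a + N%:Z.
Proof. by rewrite /lift_fun residueD; case: residue => // i; rewrite addrAC. Qed.

Lemma lift_funP (a : int) : (0 < N)%N ->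
  a < lift_fun s a <= a + N%:Z /\
  exists2 i : 'I_N, (a = i%:Z %[mod N%:Z])%Z
                  & (lift_fun s a = (s i)%:Z %[mod N%:Z])%Z.
Proof.
case/(residue_exists a) => i ai; split; last first.
  by exists i; apply/residueP => //; exact: residue_lift.
by rewrite /lift_fun ai; have := lift_gap_bounds i; lia.
Qed.

Lemma lift_funK : cancel (lift_fun s) (lift_inv s).
Proof.
move=> a; case ai: (residue N a) => [i|]; last by rewrite /lift_fun ai /lift_inv ai.
by rewrite /lift_inv (residue_lift ai) permK /lift_fun ai addrK.
Qed.

Lemma lift_invK : cancel (lift_inv s) (lift_fun s).
Proof.
move=> b; case bi: (residue N b) => [i|]; last by rewrite /lift_inv bi /lift_fun bi.
by rewrite /lift_fun (residue_lift_inv bi) /lift_inv bi subrK.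
Qed.

Definition bounded_lift : affine_perm N :=
  AffinePerm lift_funK lift_invK lift_funD.

End BoundedLift.

Definition has_type (k N : nat) (s : 'S_N) : Prop :=
  avg_displacement N (bounded_lift s) = k%:R.

(** * Positroids *)

(** [x <_a y] and [x <=_a y] in the cyclic order starting at [a]. *)
Definition cyc_pos (N : nat) (a x : 'I_N) : nat := ((x + (N - a)) %% N)%N.
Definition cyc_lt (N : nat) (a x y : 'I_N) : bool := (cyc_pos a x < cyc_pos a y)%N.
Definition cyc_le (N : nat) (a x y : 'I_N) : bool := (cyc_pos a x <= cyc_pos a y)%N.

(** Elementwise comparison of the [<_a]-increasing enumerations; false on sets
    of different cardinalities. *)
Definition gale_le (N : nat) (a : 'I_N) (I J : {set 'I_N}) : bool :=
  all2 (cyc_le a) (sort (cyc_le a) (enum I)) (sort (cyc_le a) (enum J)).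

Definition necklace (N : nat) (s : 'S_N) (a : 'I_N) : {set 'I_N} :=
  [set j | cyc_le a j ((s^-1)%g j)].

Definition positroid (k N : nat) (s : 'S_N) : {set {set 'I_N}} :=
  [set J : {set 'I_N} | (#|J| == k) && [forall a, gale_le a (necklace s a) J]].

(** * Direct sums and connected components of matroids, given by their bases *)

Definition matroid_bases (T : finType) (E : {set T}) (B : {set {set T}}) : Prop :=
  [/\ B != set0, B \subset powerset E &
      forall X Y : {set T}, X \in B -> Y \in B -> forall x, x \in X :\: Y ->
        exists2 y, y \in Y :\: X & y |: (X :\ x) \in B].

(** [B] (on the ground set [E]) is the direct sum of the [BB j] (on the disjoint
    nonempty ground sets [S j]). The summands of a matroid are necessarily
    matroids: see [direct_sum_matroid]. *)
Definition direct_sum (T I : finType) (E : {set T}) (B : {set {set T}})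
    (S : I -> {set T}) (BB : I -> {set {set T}}) : Prop :=
  [/\ forall j, S j != set0,
      forall i j, i != j -> [disjoint S i & S j],
      \bigcup_j S j = E,
      forall j, BB j \subset powerset (S j) &
      B = [set \bigcup_j (F : {ffun I -> {set T}}) j | F : {ffun I -> {set T}}
             & [forall j, F j \in BB j]]].

Definition connected (T : finType) (E : {set T}) (B : {set {set T}}) : Prop :=
  ~ exists (S : bool -> {set T}) (BB : bool -> {set {set T}}), direct_sum E B S BB.

Definition component_ground_sets (T I : finType) (B : {set {set T}})
    (S : I -> {set T}) : Prop :=
  exists2 BB : I -> {set {set T}},
    direct_sum [set: T] B S BB & forall j, connected (S j) (BB j).

Definition coloop (T : finType) (B : {set {set T}}) (x : T) : Prop :=
  forall J : {set T}, J \in B -> x \in J.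

Lemma direct_sum_matroid (T I : finType) (E : {set T}) (B : {set {set T}})
    (S : I -> {set T}) (BB : I -> {set {set T}}) :
  matroid_bases E B -> direct_sum E B S BB ->
  forall j, matroid_bases (S j) (BB j).
Proof.
move=> [/set0Pn[X0 X0B] _ exch] [_ disj _ BBS BE] j.
have inB (F : {ffun I -> {set T}}) : (forall i, F i \in BB i) -> \bigcup_i F i \in B.
  by move=> FB; rewrite BE; apply/imsetP; exists F => //; rewrite inE; apply/forallP.
have FS (F : {ffun I -> {set T}}) i x : (forall i, F i \in BB i) -> x \in F i -> x \in S i.
  move=> FB; apply: subsetP x; have /subsetP/(_ _ (FB i)) := BBS i.
  by rewrite inE.
have restr (F : {ffun I -> {set T}}) i : (forall i, F i \in BB i) ->
    (\bigcup_l F l) :&: S i = F i.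
  move=> FB; apply/setP => x; rewrite inE; apply/andP/idP => [[/bigcupP[l _ xl] xi]|xi].
    have [<- //|li] := eqVneq l i.
    by have /pred0P/(_ x)/= := disj _ _ li; rewrite xi (FS _ _ _ FB xl).
  by split; [apply/bigcupP; exists i | apply: FS xi].
have restrB X i : X \in B -> X :&: S i \in BB i.
  by rewrite BE => /imsetP[F]; rewrite inE => /forallP FB ->; rewrite restr.
split=> //; first by apply/set0Pn; exists (X0 :&: S j); apply: restrB.
move=> X Y XB YB x.
pose G (Z : {set T}) := [ffun i => if i == j then Z else X0 :&: S i].
have GB Z : Z \in BB j -> forall i, G Z i \in BB i.
  by move=> ZB i; rewrite ffunE; case: eqP => [->|_] //; apply: restrB.
have Gj Z : G Z j = Z by rewrite ffunE eqxx.
have Grestr Z : Z \in BB j -> (\bigcup_i G Z i) :&: S j = Z.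
  by move=> ZB; rewrite restr ?Gj //; apply: GB.
have Gnj Z Z' i z : i != j -> z \in G Z i -> z \in G Z' i.
  by move=> /negPf ij; rewrite !ffunE ij.
rewrite inE => /andP[xY xX].
have xS : x \in S j by apply: (FS (G X)); [exact: GB | rewrite Gj].
have xG : x \in (\bigcup_i G X i) :\: (\bigcup_i G Y i).
  rewrite inE; apply/andP; split; last by apply/bigcupP; exists j; rewrite ?Gj.
  apply: contra xY => xY; rewrite -(Grestr _ YB) inE xY xS //.
have [y] := exch _ _ (inB _ (GB _ XB)) (inB _ (GB _ YB)) _ xG.
rewrite inE => /andP[yX /bigcupP[i _ yi]] /restrB - /(_ j) yB.
have ij : i = j.
  apply/eqP; apply: contraNT yX => ij; apply/bigcupP; exists i => //.
  exact: Gnj yi.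
move: yi; rewrite {i}ij Gj => yY.
have yS : y \in S j by apply: (FS (G Y)); [exact: GB | rewrite Gj].
have yX' : y \notin X.
  by apply: contra yX => yX; apply/bigcupP; exists j; rewrite ?Gj.
exists y; first by rewrite inE yX' yY.
suff -> : y |: (X :\ x) = (y |: ((\bigcup_i G X i) :\ x)) :&: S j by [].
apply/setP => z; rewrite -{1}(Grestr _ XB) !inE.
by case: eqP => [->|_] /=; rewrite ?yS // andbA.
Qed.

(** * Admissibility *)

(** Dimension of the affine cone over the open positroid variety. *)
Definition cone_dim (k N : nat) (s : 'S_N) : int :=
  (k * (N - k))%N%:Z + 1 - (aff_length N (bounded_lift s))%:Z.

Definition le_circ (N : nat) (iota pi : 'S_N) : Prop :=
  le_R (bounded_lift iota) (bounded_lift pi).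

Definition admissible (k N : nat) (pi rho : 'S_N) : Prop :=
  [/\ has_type k pi, has_type k (pi \oS rho), le_circ (pi \oS rho) pi &
      cone_dim k (rho^-1%g \oS pi \oS rho) = cone_dim k pi].

(** * Relabelling along cyclic order-preserving bijections *)

(** [al] is a bijection from [m] onto [A], compatible with the cyclic orders
    starting at every point ([A] carries the restrictions of those of [N]). *)
Definition cyclic_bijection (m N : nat) (A : {set 'I_N}) (al : 'I_m -> 'I_N) : Prop :=
  [/\ injective al, [set al i | i : 'I_m] = A &
      forall a x y : 'I_m, cyc_lt (al a) (al x) (al y) = cyc_lt a x y].

(** [t] is the permutation [be^-1 \o s \o al] of [m]. *)
Definition induced_perm (m N : nat) (al be : 'I_m -> 'I_N) (s : 'S_N) (t : 'S_m) : Prop :=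
  forall i, be (t i) = s (al i).

(* Main.v *)
Require Import Defs.
From mathcomp Require Import finmap boolp classical_sets cardinality.
From mathcomp Require Import all_boot all_order all_algebra all_fingroup.
From mathcomp Require Import zify.

Set Implicit Arguments.
Unset Strict Implicit.
Unset Printing Implicit Defensive.

Import Order.TTheory GRing.Theory Num.Theory.

(** Put f = f_pi, u = f_(pi rho) and v = u^-1 f, a lift of rho^-1, so that
    f = u v and f_mu = v u. Admissibility says that the length is additive in both
    factorizations. Length is a sum over pairs of residues of positive parts of
    variations of floor((a - b) / N), so additivity holds pair by pair
    ("coherence") and restricts to every set of residues. In particular the number
    of inversions of f between a pi-stable set S and its complement equals that of
    f_mu for rho^-1(S).

    Two labels lie in the same component of the positroid iff no pi-stable cyclic
    interval separates them. For a pi-stable interval the number of inversions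
    above takes an explicit value, and conversely this value forces the chords
    x -> f x of S not to cross those of the complement, which is enough to separate
    S from its complement by stable intervals. Hence rho^-1 carries separated pairs
    for pi to separated pairs for mu, and conversely by symmetry.

    For a single component, restrict u and v along increasing enumerations of
    S_j + N Z and A_j + N Z by Z, shifted so that the restriction of v has
    displacement 0; coherence then makes the restriction of u bounded. *)

(** * Floors of differences divided by the period, residues and periodic functions *)

Section Turns.
Local Open Scope ring_scope.

(** The image under [rho^-1] of a stable interval is stable, but nothing makes it an interval, so a
    separating interval for [mu] has to be rebuilt from a single number, the inversion count. This
    works because the value taken by intervals is the maximum over all stable sets [S]: the
    inversions between [S] and a label [i] outside it number [disp f S - rk S i (f i)], the function
    [rk] bounds the number of elements of [S] that a necklace has in a window, and these numbers
    have a fixed sum over the windows [[i, f i)] with [i] outside [S]. Equality of the totals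
    therefore gives equality in every window. The components are defined by decompositions of the
    set of bases, so intervals must be tied to bases in both directions. Bases can be cut and glued
    along a stable interval, since its rank and that of its complement add up to [k]. Conversely, a
    summand meets all bases in the same number of elements, and this alone forces a stable interval
    between each of its labels and each label outside it. *)

Definition turns (n : nat) (a b : int) : int := ((a - b) %/ n%:Z)%Z.

Variables (n : nat) (n_gt0 : (0 < n)%N).
Implicit Types a b c d q : int.

Lemma le_turns q a b : (q <= turns n a b) = (b + q * n%:Z <= a).
Proof. by rewrite /turns lez_divRL ?ltz_nat // lerBrDl. Qed.

Lemma lt_turns q a b : (turns n a b < q) = (a < b + q * n%:Z).
Proof. by rewrite /turns ltz_divLR ?ltz_nat // ltrBlDl. Qed.

Lemma turnsP a b q : b + q * n%:Z <= a < b + q * n%:Z + n%:Z -> turns n a b = q.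
Proof.
move=> /andP[h1 h2]; apply/eqP; rewrite eq_le le_turns h1 andbT.
by rewrite -ltzD1 lt_turns mulrDl mul1r addrA.
Qed.

Lemma turns_bounds a b : b + turns n a b * n%:Z <= a < b + turns n a b * n%:Z + n%:Z.
Proof.
rewrite -le_turns lexx /=; have := ltzD1 (turns n a b) (turns n a b).
by rewrite lexx lt_turns mulrDl mul1r addrA.
Qed.

Lemma turnsDl q a b : turns n (a + q * n%:Z) b = turns n a b + q.
Proof. by apply: turnsP; have := turns_bounds a b; lia. Qed.

Lemma turnsDr q a b : turns n a (b + q * n%:Z) = turns n a b - q.
Proof. by apply: turnsP; have := turns_bounds a b; lia. Qed.

Lemma turnsDnl a b : turns n (a + n%:Z) b = turns n a b + 1.
Proof. by rewrite -[n%:Z]mul1r turnsDl. Qed.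

Lemma turnsDnr a b : turns n a (b + n%:Z) = turns n a b - 1.
Proof. by rewrite -{1}[n%:Z]mul1r turnsDr. Qed.

Lemma turns_homol a a' b : a <= a' -> turns n a b <= turns n a' b.
Proof. by move=> h; rewrite le_turns; have := turns_bounds a b; lia. Qed.

Lemma turns_homor a b b' : b <= b' -> turns n a b' <= turns n a b.
Proof. by move=> h; rewrite le_turns; have := turns_bounds a b'; lia. Qed.

Lemma turns_ge0 a b : (0 <= turns n a b) = (b <= a).
Proof. by rewrite le_turns mul0r addr0. Qed.

Lemma turns_lt0 a b : (turns n a b < 0) = (a < b).
Proof. by rewrite lt_turns mul0r addr0. Qed.

Lemma turnsaa a : turns n a a = 0.
Proof. by apply: turnsP; have := n_gt0; lia. Qed.

Fact res_subproof a : (`|(a %% n%:Z)%Z| < n)%N.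
Proof.
by rewrite -ltz_nat gez0_abs ?ltz_pmod // ?modz_ge0 // eqz_nat -lt0n.
Qed.

Definition res a : 'I_n := Ordinal (res_subproof a).

Lemma val_res a : (res a)%:Z = (a %% n%:Z)%Z.
Proof. by rewrite /= gez0_abs // modz_ge0 // eqz_nat -lt0n. Qed.

Lemma res_eq a : a = (res a)%:Z + turns n a 0 * n%:Z.
Proof. by rewrite val_res /turns subr0 addrC -divz_eq. Qed.

Lemma residueE a : residue n a = Some (res a).
Proof. by apply/residueP; rewrite val_res modz_mod. Qed.

Lemma res_ord (i : 'I_n) : res i%:Z = i.
Proof.
by apply: val_inj; apply/eqP; rewrite -eqz_nat val_res modz_small //= ltz_nat ltn_ord.
Qed.

Lemma turns_ord (i : 'I_n) : turns n i%:Z 0 = 0.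
Proof. by apply: turnsP; have := ltn_ord i; lia. Qed.

Lemma resD q a : res (a + q * n%:Z) = res a.
Proof.
by apply: val_inj; apply/eqP; rewrite -eqz_nat !val_res addrC modzMDl.
Qed.

Lemma resDn a : res (a + n%:Z) = res a.
Proof. by rewrite -{1}[n%:Z]mul1r resD. Qed.

Lemma eq_res a b : res a = res b -> b = a + turns n b a * n%:Z.
Proof.
move=> ab; have bE : b = a + (turns n b 0 - turns n a 0) * n%:Z.
  by rewrite {1}[b]res_eq {1}[a]res_eq ab; lia.
by rewrite {2}bE turnsDl turnsaa add0r.
Qed.

Lemma res_turns a b : a < b < a + n%:Z -> res a <> res b.
Proof.
move=> ab /eq_res; have /andP[] := turns_bounds b a.
have -> : turns n b a = 0 by apply: turnsP; lia.
lia.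
Qed.

Lemma periodic_turns (V : Type) (F : int -> V) :
  (forall a, F (a + n%:Z) = F a) -> forall a q, F (a + q * n%:Z) = F a.
Proof.
move=> FD a; have FDn (m : nat) b : F (b + m%:Z * n%:Z) = F b.
  elim: m b => [|m IH] b; first by rewrite mul0r addr0.
  by rewrite -addn1 PoszD mulrDl mul1r addrA FD.
case=> m; first exact: FDn.
by rewrite -(FDn m.+1 (a + _)) NegzE mulNr subrK.
Qed.

Lemma periodic_res (V : Type) (F : int -> V) :
  (forall a, F (a + n%:Z) = F a) -> forall a, F a = F (res a)%:Z.
Proof. by move=> FD a; rewrite {1}[a]res_eq periodic_turns. Qed.

(** No bound is imposed: the lift of [rho^-1] in use has displacement 0, so it is not a bounded
    lift. *)
Definition is_lift (t : 'S_n) (u : int -> int) : Prop :=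
  (forall a, u (a + n%:Z) = u a + n%:Z) /\ forall a, res (u a) = t (res a).

Lemma is_liftD t u : is_lift t u -> forall a q, u (a + q * n%:Z) = u a + q * n%:Z.
Proof.
move=> [uD _] a q; have uP b : u (b + n%:Z) - (b + n%:Z) = u b - b by rewrite uD; lia.
by have := periodic_turns uP a q; lia.
Qed.
End Turns.

(** * Lifts of permutations, and the length as a sum over pairs of residues *)

Section Lifts.
Local Open Scope ring_scope.

Definition posp (z : int) : int := if 0 <= z then z else 0.

Lemma posp_ge0 z : 0 <= posp z.
Proof. by rewrite /posp; case: ifP. Qed.

Lemma ltn_absz_posp (m : nat) z : (m < `|posp z|)%N = (m%:Z < z).
Proof. by rewrite /posp; case: ifP => h; apply/idP/idP; lia. Qed.

Variables (n : nat) (n_gt0 : (0 < n)%N).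
Implicit Types (a b c d q : int) (t : 'S_n) (u v : int -> int).
Notation res := (res n_gt0).
Notation T := (turns n).
Notation is_lift := (is_lift n_gt0).

Lemma is_lift_inj t u : is_lift t u -> injective u.
Proof.
move=> ut a b uab; have ab : res a = res b.
  by apply: (@perm_inj _ t); case: ut => _ uE; rewrite -!uE uab.
have := eq_res ab; set q := T b a => bE.
have := is_liftD ut a q; rewrite -bE -uab => h.
by rewrite bE (_ : q * n%:Z = 0) ?addr0 //; lia.
Qed.

Lemma lift_comp t t' u v : is_lift t u -> is_lift t' v -> is_lift (t \oS t') (u \o v).
Proof.
move=> [uD uE] [vD vE]; split=> a /=; first by rewrite vD uD.
by rewrite uE vE /perm_comp permM.
Qed.

Lemma turns_res a b : res a = res b -> a = b + T a b * n%:Z.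
Proof. by move=> /esym/eq_res. Qed.

Lemma lift_dturnsl t u : is_lift t u -> forall b a,
  T (u (a + n%:Z)) (u b) - T (a + n%:Z) b = T (u a) (u b) - T a b.
Proof. by move=> [uD _] b a; rewrite uD !turnsDnl //; lia. Qed.

Lemma lift_dturnsr t u : is_lift t u -> forall a b,
  T (u a) (u (b + n%:Z)) - T a (b + n%:Z) = T (u a) (u b) - T a b.
Proof. by move=> [uD _] a b; rewrite uD !turnsDnr //; lia. Qed.

Lemma sum_lift (V : zmodType) t u (F : int -> V) (P : pred 'I_n) :
  is_lift t u -> (forall a, F (a + n%:Z) = F a) ->
  \sum_(i | P (t i)) F (u i%:Z) = \sum_(i | P i) F i%:Z.
Proof.
move=> [_ uE] FD; rewrite [RHS](reindex_inj (@perm_inj _ t)) /=.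
apply: eq_bigr => i _; rewrite (periodic_res n_gt0 FD); congr (F _%:Z).
by rewrite uE res_ord.
Qed.

Lemma sum_shift1 (F : int -> int) : (forall a, F (a + n%:Z) = F a) ->
  \sum_(i < n) F (i.+1%:Z) = \sum_(i < n) F i%:Z.
Proof.
move=> FD; have := @big_ord_recr int 0 +%R n (fun i : 'I_n.+1 => F i%:Z).
rewrite big_ord_recl /= => h; have := FD 0; rewrite add0r => Fn.
move: h; rewrite Fn addrC => /addIr <-; apply: eq_bigr => i _.
by rewrite /bump.
Qed.

Definition inv_count (u : int -> int) (P Q : pred 'I_n) : int :=
  \sum_(i | P i) \sum_(j | Q j) posp (T (u i%:Z) (u j%:Z) - T i%:Z j%:Z).

(** For fixed [a] and a residue [j], the [b = j + q n] with [a < b] and [u b <= u a] are those with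
    [T a j < q <= T (u a) (u j)]. Injectivity excludes [u b = u a], so a difference of two floors
    counts the inversions. *)
Lemma aff_length_turns t u : is_lift t u ->
  (aff_length n u)%:Z = inv_count u predT predT.
Proof.
move=> ut; pose G a (j : 'I_n) := posp (T (u a) (u j%:Z) - T a j%:Z).
pose d (i j : 'I_n) := `|G i.+1%:Z j|%N.
pose TT : finType := {i : 'I_n & {j : 'I_n & 'I_(d i j)}}.
pose phi (x : TT) : int * int := let i := tag x in let j := tag (tagged x) in
  (i.+1%:Z, j%:Z + (T i.+1%:Z j%:Z + 1 + (tagged (tagged x) : nat)%:Z) * n%:Z).
have phi_inj : injective phi.
  case=> [i [j m]] [i' [j' m']] [] /= ii /eqP h.
  have {}ii : i = i' by apply: val_inj.
  subst i'; have jj : j = j'.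
    have := congr1 res (eqP h); rewrite !(resD, res_ord) //.
  subst j'; move: h; rewrite (inj_eq (addrI _)) => /eqP h.
  have : (n%:Z != 0) by rewrite eqz_nat -lt0n.
  move=> /mulIf/(_ _ _ h)/addrI/eqP; rewrite eqz_nat => /eqP mm.
  by have -> : m = m' by apply: val_inj.
have AE : [set p : int * int | [/\ 1 <= p.1 <= n%:Z, p.1 < p.2 & u p.2 < u p.1]]%classic
   = [set` [fset phi x | x in TT]%fset]%classic.
  rewrite predeqE => -[a b] /=; split; last first.
    case/imfsetP => -[i [j m]] _ [-> ->] /=; have := ltn_ord i.
    have := ltn_ord m; rewrite {2}/d /G ltn_absz_posp; move: (m : nat) => {}m.
    set A := i.+1%:Z; set q := T A j%:Z; set q' := T (u A) _ => mlt ilt.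
    have h1 : A < j%:Z + (q + 1 + m%:Z) * n%:Z by rewrite -lt_turns // -/q; lia.
    have h2 : u j%:Z + (q + 1 + m%:Z) * n%:Z <= u A.
      by rewrite -le_turns // -/q'; move: mlt; clearbody q q'; clear; lia.
    split; [by rewrite /A !lez_nat /= | by [] | ].
    rewrite (is_liftD ut) lt_neqAle h2 andbT -(is_liftD ut).
    by apply/eqP => /(is_lift_inj ut) h; move: h1; rewrite h ltxx.
  case=> a1 ab uab; have i_lt : (`|a|.-1 < n)%N by lia.
  pose i := Ordinal i_lt; have aE : a = i.+1%:Z by rewrite /=; lia.
  pose j := res b; pose q := T b j%:Z.
  have bE : b = j%:Z + q * n%:Z by apply: turns_res; rewrite res_ord.
  have q1 : T a j%:Z < q by rewrite lt_turns // -bE.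
  have q2 : q <= T (u a) (u j%:Z) by rewrite le_turns // -(is_liftD ut) -bE ltW.
  pose m := absz (q - 1 - T a j%:Z)%R.
  have mE : q = T a j%:Z + 1 + m%:Z.
    by rewrite /m; move: q1; set z := T a _; move: (q) (z); clear; lia.
  have m_lt : (m < d i j)%N.
    by rewrite /d /G -aE ltn_absz_posp;
    move: mE q2; set z := T a _; move: (q) (z) (T _ _) (m); clear; lia.
  apply/imfsetP; exists (Tagged (fun i => {j : 'I_n & 'I_(d i j)})
     (Tagged (fun j => 'I_(d i j)) (Ordinal m_lt))) => //=.
  have pE : (a, b) = (i.+1%:Z, j%:Z + (T i.+1%:Z j%:Z + 1 + m%:Z) * n%:Z).
    by rewrite -aE -mE -bE.
  exact: pE.
rewrite /aff_length AE set_fsetK card_imfset //=.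
rewrite -cardE card_tagged sumnE big_map big_enum /=.
rewrite (eq_bigr (fun i => \sum_j d i j)%N); last first.
  move=> i _; rewrite card_tagged sumnE big_map big_enum /=.
  by apply: eq_bigr => j _; rewrite card_ord.
rewrite /inv_count.
have GD a : \sum_j G (a + n%:Z) j = \sum_j G a j.
  by apply: eq_bigr => j _; rewrite /G (lift_dturnsl ut).
(* The first entries range over [{1, ..., n}] and the residues over [{0, ..., n - 1}]; periodicity
   allows the shift by one. *)
rewrite -(sum_shift1 GD) raddf_sum /=; apply: eq_bigr => i _.
rewrite raddf_sum /=; apply: eq_bigr => j _.
by rewrite /d gez0_abs // posp_ge0.
Qed.
End Lifts.

(** * Additivity of length, displacement, and bounds on the factors *)

Section Coherence.
Local Open Scope ring_scope.
Variables (n : nat) (n_gt0 : (0 < n)%N).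
Implicit Types (a b c d q : int) (t : 'S_n) (u v : int -> int).
Notation res := (res n_gt0).
Notation T := (turns n).
Notation is_lift := (is_lift n_gt0).
Notation inv_count := (@inv_count n).

Definition same_sign (p q : int) : bool := (0 <= p) && (0 <= q) || (p <= 0) && (q <= 0).

(** [turns (v a) (v b)] lies between [turns a b] and [turns (u (v a)) (u (v b))]. *)
Definition coherent u v : Prop := forall a b,
  same_sign (T (v a) (v b) - T a b) (T (u (v a)) (u (v b)) - T (v a) (v b)).

Lemma add_subrK (x y z : int) : y - x + (z - y) = z - x.
Proof. by rewrite [LHS]addrC subrKA. Qed.

Lemma pospD_le p q : posp (p + q) <= posp p + posp q.
Proof. by rewrite /posp; do 3!case: ifP; lia. Qed.

Lemma pospD p q : (posp (p + q) == posp p + posp q) = same_sign p q.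
Proof. by rewrite /posp /same_sign; do 3!case: ifP; lia. Qed.

Lemma dturns_res t u a b : is_lift t u ->
  T (u a) (u b) - T a b
  = T (u (res a)%:Z) (u (res b)%:Z) - T (res a)%:Z (res b)%:Z.
Proof.
move=> ut; rewrite (periodic_res n_gt0 (lift_dturnsl ut b)).
exact: (periodic_res n_gt0 (lift_dturnsr ut _)).
Qed.

Lemma inv_count_comp t u v (P Q : pred 'I_n) : is_lift t v ->
  inv_count u P Q = \sum_(i | P (t i)) \sum_(j | Q (t j))
     posp (T (u (v i%:Z)) (u (v j%:Z)) - T (v i%:Z) (v j%:Z)) ->
  inv_count (u \o v) (P \o t) (Q \o t) <= inv_count v (P \o t) (Q \o t) + inv_count u P Q
  /\ (coherent u v ->
  inv_count (u \o v) (P \o t) (Q \o t) = inv_count v (P \o t) (Q \o t) + inv_count u P Q).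
Proof.
move=> vt ->; rewrite /inv_count -big_split /=; split.
  apply: ler_sum => i _; rewrite -big_split /=; apply: ler_sum => j _.
  by apply: le_trans (pospD_le _ _); rewrite add_subrK.
move=> uv; apply: eq_bigr => i _; rewrite -big_split /=; apply: eq_bigr => j _.
by rewrite -(eqP (etrans (pospD _ _) (uv _ _))) add_subrK.
Qed.

Lemma inv_count_lift t t' u v (P Q : pred 'I_n) : is_lift t' u -> is_lift t v ->
  inv_count u P Q = \sum_(i | P (t i)) \sum_(j | Q (t j))
     posp (T (u (v i%:Z)) (u (v j%:Z)) - T (v i%:Z) (v j%:Z)).
Proof.
move=> ut vt; pose F a := \sum_(j | Q j) posp (T (u a) (u j%:Z) - T a j%:Z).
have FD a : F (a + n%:Z) = F a.
  by apply: eq_bigr => j _; rewrite (lift_dturnsl ut).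
rewrite -[LHS](sum_lift P vt FD); apply: eq_bigr => i _.
pose G b := posp (T (u (v i%:Z)) (u b) - T (v i%:Z) b).
have GD b : G (b + n%:Z) = G b by rewrite /G (lift_dturnsr ut).
exact: esym (sum_lift Q vt GD).
Qed.

Lemma inv_countD t t' u v (P Q : pred 'I_n) : is_lift t' u -> is_lift t v ->
  coherent u v ->
  inv_count (u \o v) (P \o t) (Q \o t) = inv_count v (P \o t) (Q \o t) + inv_count u P Q.
Proof. by move=> ut vt; case: (inv_count_comp vt (inv_count_lift P Q ut vt)). Qed.

(** The defect of additivity is a sum of terms [posp p + posp q - posp (p + q)]. They are
    nonnegative, and such a term vanishes exactly when [p] and [q] do not have opposite signs. *)
Lemma aff_length_coherent t t' u v : is_lift t' u -> is_lift t v ->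
  aff_length n (u \o v) = (aff_length n u + aff_length n v)%N <-> coherent u v.
Proof.
move=> ut vt; have uvt := lift_comp ut vt.
have -> : (aff_length n (u \o v) = aff_length n u + aff_length n v)%N <->
    inv_count (u \o v) predT predT = inv_count v predT predT + inv_count u predT predT.
  rewrite -(aff_length_turns uvt) -(aff_length_turns vt) -(aff_length_turns ut).
  by split=> [->|/eqP]; [rewrite PoszD addrC | rewrite -PoszD eqz_nat addnC => /eqP].
split=> [uvE a b|]; last exact: (inv_countD predT predT ut vt).
rewrite (dturns_res (v a) (v b) ut).
have [_ vE] := vt; rewrite (dturns_res a b vt).
rewrite !vE; move: (res a) (res b) => {a b} i j.
have <- : T (u (v i%:Z)) (u (v j%:Z)) - T (v i%:Z) (v j%:Z) =
    T (u (t i)%:Z) (u (t j)%:Z) - T (t i)%:Z (t j)%:Z.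
  by rewrite (dturns_res _ _ ut) !vE !res_ord.
pose D (i j : 'I_n) := posp (T (v i%:Z) (v j%:Z) - T i%:Z j%:Z)
   + posp (T (u (v i%:Z)) (u (v j%:Z)) - T (v i%:Z) (v j%:Z))
   - posp (T (u (v i%:Z)) (u (v j%:Z)) - T i%:Z j%:Z).
have D_ge0 (i' j' : 'I_n) : 0 <= D i' j'.
  by rewrite /D subr_ge0; apply: le_trans (pospD_le _ _); rewrite add_subrK.
have : \sum_i \sum_j D i j = 0.
  apply/eqP; rewrite -(subr_eq0 _ 0) subr0.
  under eq_bigr do rewrite sumrB big_split /=.
  rewrite sumrB big_split /= subr_eq0 eq_sym; apply/eqP.
  by rewrite -(inv_count_lift predT predT ut vt); exact: uvE.
move=> /psumr_eq0P h; have /psumr_eq0P h' := h (fun i _ => sumr_ge0 _ (fun j _ => D_ge0 i j)) i isT.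
have := h' (fun j _ => D_ge0 i j) j isT; rewrite /D => /eqP.
by rewrite subr_eq0 eq_sym -pospD add_subrK.
Qed.

(** Over a set of residues stable under [u], this is the sum of the [u i - i] divided by [n],
    because the residues cancel. Written with floors it is visibly an integer. *)
Definition disp u (P : pred 'I_n) : int := \sum_(i | P i) (T (u i%:Z) 0 - T i%:Z 0).

Lemma disp_comp t t' u v (P : pred 'I_n) : is_lift t' u -> is_lift t v ->
  disp (u \o v) (P \o t) = disp v (P \o t) + disp u P.
Proof.
move=> ut vt; have FD a : T (u (a + n%:Z)) 0 - T (a + n%:Z) 0 = T (u a) 0 - T a 0.
  by case: ut => uD _; rewrite uD !turnsDnl //; lia.
rewrite /disp -(sum_lift P vt FD) -big_split /=; apply: eq_bigr => i _.
by rewrite add_subrK.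
Qed.

Lemma disp_at t u (P : pred 'I_n) c : is_lift t u -> (forall i, P (t i) = P i) ->
  \sum_(i | P i) (T (u i%:Z) c - T i%:Z c) = disp u P.
Proof.
move=> ut Pt; apply/eqP; rewrite -subr_eq0 /disp -sumrB.
have FD a : T (a + n%:Z) c - T (a + n%:Z) 0 = T a c - T a 0.
  by rewrite !turnsDnl //; lia.
have h := sum_lift P ut FD; rewrite (eq_bigl P) in h; last by move=> i; rewrite Pt.
rewrite (eq_bigr (fun i : 'I_n => T (u i%:Z) c - T (u i%:Z) 0 - (T i%:Z c - T i%:Z 0))).
  by rewrite sumrB h subrr.
by move=> i _; lia.
Qed.

Lemma avg_displacementE t u : is_lift t u ->
  avg_displacement n u = (disp u predT)%:~R.
Proof.
move=> ut; rewrite /avg_displacement.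
have -> : \sum_(1 <= a < n.+1) (u a%:Z - a%:Z) = disp u predT * n%:Z.
  rewrite big_add1 /= big_mkord (@sum_shift1 n (fun a => u a - a)); last first.
    by move=> a; case: ut => uD _; rewrite uD; lia.
  rewrite /disp mulr_suml.
  have FD a : (res (a + n%:Z))%:Z = (res a)%:Z by rewrite resDn.
  have h := sum_lift predT ut FD; apply/eqP; rewrite -subr_eq0 -sumrB.
  rewrite (eq_bigr (fun i : 'I_n => (res (u i%:Z))%:Z - (res i%:Z)%:Z)).
    by rewrite sumrB h subrr.
  move=> i _; rewrite turns_ord // res_ord.
  by have := res_eq n_gt0 (u i%:Z); lia.
by rewrite intrM mulfK // pnatr_eq0 -lt0n.
Qed.

Definition bounded u : Prop := forall a, a < u a <= a + n%:Z.

Lemma lift_fun_lift t : is_lift t (lift_fun t).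
Proof.
split=> a; first exact: lift_funD.
have := residue_lift t (residueE n_gt0 a).
by rewrite (residueE n_gt0) => -[].
Qed.

Lemma lift_fun_bounded t : bounded (lift_fun t).
Proof. by move=> a; case: (lift_funP t a n_gt0). Qed.

Lemma bounded_uniq t u : is_lift t u -> bounded u -> u =1 lift_fun t.
Proof.
move=> ut ub a; have resE : res (u a) = res (lift_fun t a).
  by rewrite ut.2 (lift_fun_lift t).2.
have [h1 h2] := (ub a, lift_fun_bounded t a).
by case: (ltgtP (u a) (lift_fun t a)) => // h;
  [case: (@res_turns _ n_gt0 (u a) (lift_fun t a)) | case: (@res_turns _ n_gt0 (lift_fun t a) (u a))];
  rewrite ?resE //; lia.
Qed.

(** The order of [v a] and [v b] is the sign of a floor lying between two negative ones. *)
Lemma coherent_lt u v a b : coherent u v ->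
  a < b -> u (v a) < u (v b) -> v a < v b.
Proof.
move=> /(_ a b); have := (turns_lt0 n_gt0 a b, turns_lt0 n_gt0 (v a) (v b)).
by move=> [<- <-]; rewrite -(turns_lt0 n_gt0 (u (v a))) /same_sign; lia.
Qed.

Lemma coherent_le u v a b : coherent u v ->
  a <= b -> u (v a) <= u (v b) -> v a <= v b.
Proof.
move=> /(_ b a); have := (turns_ge0 n_gt0 b a, turns_ge0 n_gt0 (v b) (v a)).
by move=> [<- <-]; rewrite -(turns_ge0 n_gt0 (u (v b))) /same_sign; lia.
Qed.

(** With [f = u \o v], the point [v (f a)] is the value of [v \o u] at [v a]. Comparing [a < f a]
    with [f a < f (f a)], and likewise the upper bounds, gives the order of the images under [v]. *)
Lemma bounded_conj t u v : is_lift t v -> coherent u v -> 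
  bounded (u \o v) -> (forall a, (u \o v) (a + n%:Z) = (u \o v) a + n%:Z) ->
  forall a, v a < v (u (v a)) <= v a + n%:Z.
Proof.
move=> [vD _] uv fb fD a; have /andP[h1 h2] := fb a; apply/andP; split.
  by apply: (coherent_lt uv h1); have /andP[] := fb (u (v a)).
rewrite -vD; apply: (coherent_le uv h2); rewrite [leRHS]fD.
by have /andP[] := fb (u (v a)).
Qed.

(** Summands of one sign with sum zero all vanish: a lift of displacement 0 that carries points
    across [c + n Z] in one direction only carries none across. *)
Lemma disp0_turns t u c : is_lift t u -> disp u predT = 0 ->
  (forall a, T a c <= T (u a) c) \/ (forall a, T (u a) c <= T a c) ->
  forall a, T (u a) c = T a c.
Proof.
move=> ut u0 h a; have := @disp_at t u predT c ut (fun _ => erefl).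
rewrite u0 => s0; apply/eqP; rewrite -subr_eq0.
have FD b : T (u (b + n%:Z)) c - T (b + n%:Z) c = T (u b) c - T b c.
  by case: ut => uD _; rewrite uD !turnsDnl //; lia.
rewrite (periodic_res n_gt0 FD); move: (res a) => i.
case: h => h.
  by move/psumr_eq0P: s0 => -> // j _; rewrite subr_ge0.
rewrite -oppr_eq0; move/eqP: s0; rewrite -oppr_eq0 -sumrN => /eqP.
by move/psumr_eq0P => -> // j _; rewrite oppr_ge0 subr_le0.
Qed.

Lemma turns_le_turns c u : (forall a q, u (a + q * n%:Z) = u a + q * n%:Z) ->
  (forall a, c <= a -> c <= u a) -> forall a, T a c <= T (u a) c.
Proof.
move=> uD h a; rewrite le_turns //; have := turns_bounds n_gt0 a c.
have := h (a + (- T a c) * n%:Z); rewrite uD; lia.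
Qed.

Lemma turns_ge_turns c u : (forall a q, u (a + q * n%:Z) = u a + q * n%:Z) ->
  (forall a, a < c -> u a < c) -> forall a, T (u a) c <= T a c.
Proof.
move=> uD h a; rewrite -ltzD1 lt_turns //; have := turns_bounds n_gt0 a c.
have := h (a + (- (T a c + 1)) * n%:Z); rewrite uD; lia.
Qed.

(** If [u (v a) <= v a], coherence shows that [v] maps the half-line from [v a] upwards into itself.
    By displacement 0 no point may then enter this half-line, yet [a < u (v a) <= v a] lies outside
    and is sent to its end point. The upper bound is the mirror image, with the half-line below
    [v a + 1]. *)
Lemma bounded_factor t u v : is_lift t v -> coherent u v ->
  disp v predT = 0 -> bounded (u \o v) -> forall a, v a < u (v a) <= v a + n%:Z.
Proof.
move=> vt uv v0 fb a; have vD := is_liftD vt.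
have v0T c := @disp0_turns t v c vt v0.
rewrite ltNge [X in _ && X]leNgt -negb_or; apply/negP => /orP[] h.
  suff hv b : v a <= b -> v a <= v b.
    have := v0T (v a) (or_introl (turns_le_turns vD hv)) a; rewrite turnsaa //.
    move=> /(congr1 (fun z => 0 <= z)); rewrite turns_ge0 // lexx.
    by have := fb a => /=; lia.
  move=> vab; rewrite leNgt; apply/negP => vba.
  have ab : a < b by have := fb a => /=; lia.
  have := fb b => /=; have : u (v b) <= u (v a); last by lia.
  rewrite leNgt; apply/negP => /(coherent_lt uv ab); lia.
suff hv b : b < v a + 1 -> v b < v a + 1.
  have := v0T (v a + 1) (or_intror (turns_ge_turns vD hv)) a.
  move=> /(congr1 (fun z => 0 <= z)); rewrite !turns_ge0 //.
  by have := fb a => /=; lia.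
rewrite ltzD1 => vab; rewrite ltzD1 leNgt; apply/negP => vba.
have ab : b < a by have := fb a => /=; lia.
have := fb b => /=; have : u (v a) <= u (v b); last by lia.
rewrite leNgt; apply/negP => /(coherent_lt uv ab); lia.
Qed.
End Coherence.

(** This turns the Gale order into inequalities between counting functions, which add up over
    consecutive windows. *)
Lemma all2_leq_sorted (s1 s2 : seq nat) : sorted leq s1 -> sorted leq s2 ->
  reflect (size s1 = size s2 /\
      forall t, (count (fun x => x < t) s2 <= count (fun x => x < t) s1)%N)
    (all2 leq s1 s2).
Proof.
elim: s1 s2 => [|x s1 IH] [|y s2] /=; try by [constructor | constructor; case].
move=> xs1 ys2; have [s1s s2s] := (path_sorted xs1, path_sorted ys2).
have xmin := order_path_min leq_trans xs1; have ymin := order_path_min leq_trans ys2.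
have y0 t : (t <= y)%N -> count (fun z => z < t)%N s2 = 0.
  move=> ty; rewrite (@eq_in_count _ _ pred0) ?count_pred0 // => z /(allP ymin) yz /=.
  by apply/negbTE; rewrite -leqNgt (leq_trans ty).
apply: (iffP andP) => [[xy /(IH _ s1s s2s)[-> h]]|[[/eqP sz] h]].
  by split=> // t; apply: leq_add => //; case: (ltnP y t) => // /(leq_ltn_trans xy) ->.
split.
  rewrite leqNgt; apply/negP => yx; have := h y.+1.
  have -> : (x < y.+1)%N = false by rewrite ltnS leqNgt yx.
  suff -> : count (fun x => x < y.+1)%N s1 = 0 by rewrite ltnSn.
  rewrite (@eq_in_count _ _ pred0) ?count_pred0 // => z /(allP xmin) xz /=.
  by apply/negbTE; rewrite ltnS -ltnNge (leq_trans yx).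
apply/(IH _ s1s s2s); split; first exact/eqP.
move=> t; have := h t; case: (ltnP y t) => [yt|ty]; last by rewrite y0.
by case: (x < t)%N; rewrite ?add1n ?add0n ?leq_add2l // => /ltnW.
Qed.

(** * Gale order, necklaces, and the rank bounds on cyclic intervals *)

Section Ranks.
Local Open Scope ring_scope.
Variables (n : nat) (n_gt0 : (0 < n)%N).
Implicit Types (a b c d q : int) (I J S : {set 'I_n}) (i j : 'I_n).
Notation res := (res n_gt0).
Notation T := (turns n).

(** The number of elements of [J + n Z] in [[0, d)], counted negatively if [d < 0]. *)
Definition cum J d : int := - \sum_(i in J) T i%:Z d.

Lemma cumD J d q : cum J (d + q * n%:Z) = cum J d + q * #|J|%:Z.
Proof.
rewrite /cum (eq_bigr (fun i : 'I_n => T i%:Z d - q)); last by move=> i _; rewrite turnsDr.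
by rewrite sumrB sumr_const opprB addrC -mulr_natr natz.
Qed.

Lemma cumDn J d : cum J (d + n%:Z) = cum J d + #|J|%:Z.
Proof. by rewrite -{1}[n%:Z]mul1r cumD mul1r. Qed.

Lemma cumB J c d : cum J d - cum J c = \sum_(i in J) (T i%:Z c - T i%:Z d).
Proof. by rewrite /cum opprK addrC -sumrB. Qed.

Lemma turns_succ a d : T a d - T a (d + 1) = (res a == res d)%:R.
Proof.
have h := turns_bounds n_gt0 a d; case: eqP => [/eq_res aE|ne].
  have dE : d = a + T d a * n%:Z := aE.
  have -> : T a d = - T d a by rewrite dE turnsDr // turnsDl // !turnsaa //; lia.
  rewrite {2}dE addrAC turnsDr //.
  have -> : T a (a + 1) = -1 by apply: turnsP; have := n_gt0; lia.
  lia.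
rewrite (_ : T a (d + 1) = T a d) ?subrr //; apply: turnsP => //.
case: (eqVneq a (d + T a d * n%:Z)) => [aE|]; last by lia.
by case: ne; rewrite aE resD.
Qed.

Lemma cumS J d : cum J (d + 1) - cum J d = (res d \in J)%:R.
Proof.
rewrite cumB (eq_bigr (fun i => (i == res d)%:R)); last first.
  by move=> i _; rewrite turns_succ res_ord.
case: (boolP (res d \in J)) => h.
  by rewrite (bigD1 (res d)) //= eqxx big1 ?addr0 // => i /andP[_ /negPf ->].
by rewrite big1 // => i iJ; case: eqP => // ie; rewrite -ie iJ in h.
Qed.

Lemma cyc_posE i j : i%:Z = j%:Z + T i%:Z j%:Z * n%:Z + (cyc_pos j i)%:Z.
Proof.
rewrite /cyc_pos -modz_nat PoszD -subzn; last exact/ltnW/ltn_ord.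
have := divz_eq (i%:Z - j%:Z) n%:Z; rewrite -/(T i%:Z j%:Z).
rewrite (_ : i%:Z + (n%:Z - j%:Z) = i%:Z - j%:Z + n%:Z) ?modzDr; [|lia].
by move: (modz _ _) (T _ _) => x y; lia.
Qed.

Lemma cyc_pos_lt i j : (cyc_pos j i < n)%N.
Proof. by rewrite /cyc_pos ltn_pmod. Qed.

Lemma cyc_pos_turns i j t : (t <= n)%N ->
  T i%:Z j%:Z - T i%:Z (j%:Z + t%:Z) = (cyc_pos j i < t)%N%:R.
Proof.
move=> tn; have h := cyc_posE i j; have h' := cyc_pos_lt i j.
case: ltnP => ct.
  by rewrite (@turnsP _ n_gt0 _ (j%:Z + t%:Z) (T i%:Z j%:Z - 1)); lia.
by rewrite (@turnsP _ n_gt0 _ (j%:Z + t%:Z) (T i%:Z j%:Z)); lia.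
Qed.

Lemma gale_leP j I J : #|I| = #|J| ->
  reflect (forall t, (t <= n)%N -> cum J (j%:Z + t%:Z) - cum J j%:Z
                       <= cum I (j%:Z + t%:Z) - cum I j%:Z)
    (gale_le j I J).
Proof.
move=> IJ; pose p := cyc_pos j; pose s (K : {set 'I_n}) := map p (sort (cyc_le j) (enum K)).
have ss K : sorted leq (s K).
  by rewrite sorted_map; apply: sort_sorted => x y; apply: leq_total.
have size_s K : size (s K) = #|K| by rewrite size_map size_sort -cardE.
have count_s K t : count (fun x => x < t)%N (s K) = (\sum_(i in K) (p i < t))%N.
  rewrite count_map (seq.permP (permEl (perm_sort _ _))) -sum1_count big_mkcond.
  by rewrite big_enum; apply: eq_bigr => i _ /=; case: ltnP.
have -> : gale_le j I J = all2 leq (s I) (s J).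
  rewrite /gale_le /s; elim: (sort _ (enum I)) (sort _ (enum J)) => [|x s1 IH] [|y s2] //=.
  by rewrite IH.
have cum_s K t : (t <= n)%N ->
    (count (fun x => x < t)%N (s K))%:Z = cum K (j%:Z + t%:Z) - cum K j%:Z.
  move=> tn; rewrite count_s cumB raddf_sum /=; apply: eq_bigr => i _.
  by rewrite cyc_pos_turns // natz.
apply: (iffP (all2_leq_sorted (ss I) (ss J))) => [[_ h] t tn|h].
  by rewrite -!cum_s // lez_nat h.
split; first by rewrite !size_s.
move=> t; case: (leqP t n) => tn; first by rewrite -lez_nat !cum_s // h.
suff count_card K : count (fun x => x < t)%N (s K) = #|K| by rewrite !count_card IJ.
by rewrite count_s -sum1_card; apply: eq_bigr => i _; rewrite (ltn_trans (cyc_pos_lt i j)).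
Qed.

Variables (s : 'S_n) (f : int -> int).
Hypotheses (fs : is_lift n_gt0 s f) (fb : bounded n f).

Definition stable S : Prop := forall i, (s i \in S) = (i \in S).

(** On a stable [S], the number of orbits of [f] in [S + n Z] that meet
    [[c, d)]; the subtracted sum counts the arcs from [x < c] to [f x >= d]. *)
Definition rk S c d : int :=
  disp f (mem S) - \sum_(i in S) posp (T (f i%:Z) d - T i%:Z c).

Lemma turns_lift_diff a c : 0 <= T (f a) c - T a c <= 1.
Proof.
have /andP[h1 h2] := fb a; have h3 := turns_homol n_gt0 c (ltW h1).
have := turns_homol n_gt0 c h2; rewrite turnsDnl //; lia.
Qed.

Lemma disp_stable S c : stable S ->
  \sum_(i in S) (T (f i%:Z) c - T i%:Z c) = disp f (mem S).
Proof. by move=> Ss; apply: (disp_at c fs) => i; apply: Ss. Qed.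

Lemma rkD S c d : rk S (c + n%:Z) (d + n%:Z) = rk S c d.
Proof.
rewrite /rk; congr (_ - _); apply: eq_bigr => i _; rewrite !turnsDnr //.
by congr posp; lia.
Qed.

Lemma rkE S c d : stable S -> rk S c d =
  \sum_(i in S) (T (f i%:Z) c - T i%:Z c - posp (T (f i%:Z) d - T i%:Z c)).
Proof. by move=> Ss; rewrite sumrB disp_stable. Qed.

Lemma rk0 S c : stable S -> rk S c c = 0.
Proof.
move=> Ss; rewrite rkE // big1 // => i _.
by have := turns_lift_diff i%:Z c; rewrite /posp; case: ifP; lia.
Qed.

Lemma rkn S c : rk S c (c + n%:Z) = disp f (mem S).
Proof.
rewrite /rk big1 ?subr0 // => i _; rewrite turnsDnr //.
by have := turns_lift_diff i%:Z c; rewrite /posp; case: ifP; lia.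
Qed.

(** Label by label, this is the Monge inequality for the convex function [posp] of a difference of
    two monotone quantities. *)
Lemma rk_submod S c c' d d' : c <= c' -> d <= d' ->
  rk S c d' + rk S c' d <= rk S c d + rk S c' d'.
Proof.
move=> cc' dd'; rewrite /rk.
have : \sum_(i in S) (posp (T (f i%:Z) d - T i%:Z c) + posp (T (f i%:Z) d' - T i%:Z c'))
    <= \sum_(i in S) (posp (T (f i%:Z) d' - T i%:Z c) + posp (T (f i%:Z) d - T i%:Z c')).
  apply: ler_sum => i _.
  have := turns_homor n_gt0 i%:Z cc'; have := turns_homor n_gt0 (f i%:Z) dd'.
  by rewrite /posp; do 4!case: ifP; lia.
by rewrite !big_split ![_ - _ + (_ - _)]addrACA -!opprD lerD2l lerN2.
Qed.

Lemma lift_res a : f a = (s (res a))%:Z + T (f a) 0 * n%:Z.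
Proof. by rewrite {1}(res_eq n_gt0 (f a)) fs.2. Qed.

(** The arc from [i] to [f i] passes over [j] modulo [n]. As [f i - i] lies in [(0, n]], a fixed
    point has [f i = i + n] and passes over every [j], in agreement with the weak inequality
    defining the necklace. *)
Lemma mem_necklace j i :
  (s i \in necklace s j) = (T (f i%:Z) j%:Z - T i%:Z j%:Z == 1).
Proof.
rewrite inE permK /cyc_le; have := cyc_posE i j; have := cyc_posE (s i) j.
have := cyc_pos_lt i j; have := cyc_pos_lt (s i) j.
have fE := lift_res i%:Z; rewrite res_ord in fE.
have -> : T (s i)%:Z j%:Z = T (f i%:Z) j%:Z - T (f i%:Z) 0.
  by rewrite [in X in _ = X - _]fE turnsDl // addrK.
have := fb i%:Z; rewrite {1 2}fE {fE}.
move: (T (f i%:Z) j%:Z) (T (f i%:Z) 0) (T i%:Z j%:Z) (cyc_pos _ _) (cyc_pos _ _) => x y z u v.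
move: (s i : nat) (i : nat) (j : nat) => {}i' {}i {}j /andP[h5 h6] h1 h2 h3 h4.
have e : (x - z) * n%:Z + v%:Z - u%:Z > 0 by lia.
have e' : (x - z) * n%:Z + v%:Z - u%:Z <= n%:Z by lia.
move: e e'; move: (x - z) => w e e'; clear -e e' h1 h2.
by apply/idP/eqP => h; [nia | lia].
Qed.

Lemma cum_necklace j S d : stable S -> j%:Z <= d <= j%:Z + n%:Z ->
  cum (necklace s j :&: S) d - cum (necklace s j :&: S) j%:Z = rk S j%:Z d.
Proof.
move=> Ss jd; rewrite rkE // cumB (reindex_inj (@perm_inj _ s)) /=.
rewrite (eq_bigl (fun i => (i \in S) && (s i \in necklace s j))); last first.
  by move=> i; rewrite inE Ss andbC.
rewrite big_mkcondr /=; apply: eq_bigr => i _.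
rewrite mem_necklace; have := turns_lift_diff i%:Z j%:Z.
have fE := lift_res i%:Z; rewrite res_ord in fE.
have -> : T (s i)%:Z j%:Z - T (s i)%:Z d = T (f i%:Z) j%:Z - T (f i%:Z) d.
  by rewrite [in RHS]fE !turnsDl //; lia.
have /andP[jd1 jd2] := jd.
have := turns_homor n_gt0 (f i%:Z) jd1; have := turns_homor n_gt0 (f i%:Z) jd2.
by rewrite turnsDnr // /posp; case: eqP; case: ifP; lia.
Qed.

Lemma card_necklace j S : stable S ->
  #|necklace s j :&: S|%:Z = disp f (mem S).
Proof.
move=> Ss; rewrite -(rkn S j%:Z) -cum_necklace //; last by rewrite lexx; lia.
by rewrite cumDn addrC addKr.
Qed.

(** On windows starting at [j] the necklace attains [rk]. Submodularity compares any other window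
    with these, in two cases according to whether it passes [j + n]. *)
Lemma cum_necklace_le j S c d : stable S -> c <= d <= c + n%:Z ->
  cum (necklace s j :&: S) d - cum (necklace s j :&: S) c <= rk S c d.
Proof.
move=> Ss; set B := _ :&: _; set q := T c j%:Z.
have [c' cE] : exists c', c = c' + q * n%:Z by exists (c - q * n%:Z); rewrite subrK.
have [d' dE] : exists d', d = d' + q * n%:Z by exists (d - q * n%:Z); rewrite subrK.
have -> : rk S c d = rk S c' d'.
  rewrite cE dE; pose F a := rk S a (a + (d' - c')).
  have FD a : F (a + n%:Z) = F a by rewrite /F addrAC rkD.
  have := periodic_turns FD c' q; rewrite /F (_ : c' + (d' - c') = d'); last by lia.
  by rewrite (_ : c' + q * n%:Z + (d' - c') = d' + q * n%:Z) //; lia.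
rewrite cE dE !cumD; have := turns_bounds n_gt0 c j%:Z; rewrite -/q {1 2}cE => jc cd.
have {jc cE} jc : j%:Z <= c' < j%:Z + n%:Z by move: jc; clear; lia.
have {cd dE} cd : c' <= d' <= c' + n%:Z by move: cd; clear; lia.
have -> : cum B d' + q * #|B|%:Z - (cum B c' + q * #|B|%:Z) = cum B d' - cum B c' by lia.
have cB e : j%:Z <= e <= j%:Z + n%:Z -> cum B e = rk S j%:Z e + cum B j%:Z.
  by move=> je; rewrite -cum_necklace // subrK.
have /cB cBc : j%:Z <= c' <= j%:Z + n%:Z by lia.
case: (lerP d' (j%:Z + n%:Z)) => dj.
  have /cB cBd : j%:Z <= d' <= j%:Z + n%:Z by lia.
  have := @rk_submod S j%:Z c' c' d'; rewrite rk0 //; lia.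
have [d1 dE] : exists d1, d' = d1 + n%:Z by exists (d' - n%:Z); rewrite subrK.
have /cB cBd : j%:Z <= d1 <= j%:Z + n%:Z by lia.
rewrite dE cumDn card_necklace //.
have := @rk_submod S c' (j%:Z + n%:Z) d' (c' + n%:Z).
by rewrite rkn dE !rkD; lia.
Qed.

Lemma stableT : stable setT.
Proof. by move=> i; rewrite !inE. Qed.

Lemma stableC S : stable S -> stable (~: S).
Proof. by move=> Ss i; rewrite !inE Ss. Qed.

Variable k : nat.
Hypothesis fk : disp f (predT : pred 'I_n) = k%:Z.

Lemma disp_setT : disp f (mem [set: 'I_n]) = k%:Z.
Proof. by rewrite -fk; apply: eq_bigl => i; apply: in_setT. Qed.

Lemma card_necklaceT j : #|necklace s j| = k.
Proof.
apply/eqP; rewrite -eqz_nat; have := card_necklace j stableT.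
by rewrite setIT disp_setT => ->.
Qed.

(** Upper bounds on cyclic intervals cut out the positroid because the necklace at [j] attains [rk]
    on every window starting at [j]; periodicity provides the remaining starting points. *)
Lemma positroidP J : reflect
  (#|J| = k /\ forall c d, c <= d <= c + n%:Z -> cum J d - cum J c <= rk setT c d)
  (J \in positroid k s).
Proof.
rewrite inE; apply: (iffP andP) => [[/eqP Jk /forallP h]|[Jk h]]; split=> //; last 2 first.
- exact/eqP.
- apply/forallP => j; apply/gale_leP; first by rewrite card_necklaceT Jk.
  move=> t tn; have jt : j%:Z <= j%:Z + t%:Z <= j%:Z + n%:Z by lia.
  by rewrite -[necklace s j]setIT (cum_necklace stableT jt) h.
move=> c d cd; pose F a := rk setT a (a + (d - c)) - (cum J (a + (d - c)) - cum J a).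
have FD a : F (a + n%:Z) = F a.
  rewrite /F (_ : a + n%:Z + (d - c) = a + (d - c) + n%:Z); last by lia.
  by rewrite rkD !cumDn; lia.
suff : 0 <= F c by rewrite /F (_ : c + (d - c) = d) ?subr_ge0 //; lia.
rewrite (periodic_res n_gt0 FD); move: (res c) => j; rewrite /F subr_ge0.
have [t tE] : exists t : nat, d - c = t%:Z by exists `|d - c|%N; lia.
have jt : j%:Z <= j%:Z + t%:Z <= j%:Z + n%:Z by lia.
rewrite tE -(cum_necklace stableT jt) setIT.
have /gale_leP := h j; apply; first by rewrite card_necklaceT Jk.
lia.
Qed.

Lemma necklace_positroid j : necklace s j \in positroid k s.
Proof.
apply/positroidP; split; first exact: card_necklaceT.
by move=> c d; rewrite -[necklace s j]setIT; apply: (cum_necklace_le _ stableT).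
Qed.
End Ranks.

(** * Direct sums of set systems, and gluing of bases *)

Section DirectSums.
Variables (T I : finType).

Section Replace.
Variables (E : {set T}) (B : {set {set T}}) (S : I -> {set T}) (BB : I -> {set {set T}}).
Hypothesis dsum : direct_sum E B S BB.

Lemma direct_sum_restr J i : J \in B -> J :&: S i \in BB i.
Proof.
case: dsum => _ disj _ BBS ->; case/imsetP => F; rewrite inE => /forallP FB ->.
suff -> : (\bigcup_j F j) :&: S i = F i by [].
have FS j x : x \in F j -> x \in S j.
  by apply: subsetP x; have /subsetP/(_ _ (FB j)) := BBS j; rewrite inE.
apply/setP => x; rewrite inE; apply/andP/idP => [[/bigcupP[l _ xl] xi]|xi].
  have [<- //|li] := eqVneq l i.
  by have /pred0P/(_ x)/= := disj _ _ li; rewrite xi (FS _ _ xl).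
by split; [apply/bigcupP; exists i | apply: FS].
Qed.

Lemma direct_sum_subset J : J \in B -> J \subset E.
Proof.
case: dsum => _ _ <- BBS ->; case/imsetP => F; rewrite inE => /forallP FB ->.
apply/bigcupsP => i _; apply: subset_trans (bigcup_sup i _) => //.
by have /subsetP/(_ _ (FB i)) := BBS i; rewrite inE.
Qed.

Lemma direct_sum_replace i X J : X \in BB i -> J \in B -> X :|: (J :\: S i) \in B.
Proof.
move=> Xi JB; have JE := direct_sum_subset JB; have JBB j := direct_sum_restr j JB.
case: dsum => _ disj SE BBS BE; rewrite BE; apply/imsetP.
exists [ffun j => if j == i then X else J :&: S j].
  by rewrite inE; apply/forallP => j; rewrite ffunE; case: eqP => [->|].
apply/setP => x; rewrite !inE; apply/idP/bigcupP => [/orP[xX|/andP[xi xJ]]|[j _]].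
- by exists i; rewrite // ffunE eqxx.
- have := subsetP JE _ xJ; rewrite -SE => /bigcupP[j _ xj]; exists j => //.
  by rewrite ffunE; case: eqP => [ji|_]; [rewrite -ji xj in xi | rewrite inE xJ].
- rewrite ffunE; case: eqP => [_ -> //|/eqP ji]; rewrite inE => /andP[-> xj].
  by have /pred0P/(_ x)/= := disj _ _ ji; rewrite xj /= => ->; rewrite orbT.
Qed.

Lemma direct_sum_replaceI i X (J : {set T}) :
  X \in BB i -> (X :|: (J :\: S i)) :&: S i = X.
Proof.
case: dsum => _ _ _ BBS _ Xi; have /subsetP/(_ _ Xi) := BBS i; rewrite inE => /setIidPl XS.
by rewrite setIUl XS setIDAC setIC setDIl setDv set0I setU0.
Qed.

(** Replacing [J :&: S i] by [J' :&: S i] in [J] yields a basis, of the same cardinality as [J]. *)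
Lemma direct_sum_card i m : (forall J, J \in B -> #|J| = m) ->
  forall J J', J \in B -> J' \in B -> #|J :&: S i| = #|J' :&: S i|.
Proof.
move=> Bm J J' JB J'B; have J'i := direct_sum_restr i J'B.
apply/eqP; rewrite -(eqn_add2r #|J :\: S i|) cardsID (Bm _ JB).
rewrite -(Bm _ (direct_sum_replace J'i JB)) -(cardsID (S i) (_ :|: _)).
rewrite direct_sum_replaceI // eqn_add2l; apply/eqP/eq_card => x.
by rewrite !inE; case: (x \in S i); rewrite ?andbF.
Qed.
End Replace.

Variable B : {set {set T}}.
Implicit Types U V : {set T}.

(** Bases can be cut and glued along [U]. Closure under Boolean operations lets this pass from the
    separating intervals to the components, which need not be intervals. *)
Definition mixable (U : {set T}) : Prop :=
  forall J J', J \in B -> J' \in B -> (J :&: U) :|: (J' :\: U) \in B.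

Lemma mixableC U : mixable U -> mixable (~: U).
Proof.
by move=> mU J J' JB J'B; rewrite setUC -setDE setDE setCK; apply: mU.
Qed.

Lemma mixableI U V : mixable U -> mixable V -> mixable (U :&: V).
Proof.
move=> mU mV J J' JB J'B; have := mV _ _ (mU _ _ JB J'B) J'B.
congr (_ \in B); apply/setP => x; rewrite !inE.
by do 4!case: (x \in _).
Qed.

Lemma mixableU U V : mixable U -> mixable V -> mixable (U :|: V).
Proof.
move=> mU mV; rewrite -[U :|: V]setCK setCU; apply: mixableC.
by apply: mixableI; apply: mixableC.
Qed.

Lemma mixableT : mixable setT.
Proof. by move=> J J' JB _; rewrite setIT setDT setU0. Qed.

(** [U] is the union, over [x] in [U], of the intersections, over [y] outside [U], of sets [V]
    containing [x] but not [y]. *)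
Lemma mixable_sep U : (forall x y, x \in U -> y \notin U ->
    exists2 V, mixable V & (x \in V) && (y \notin V)) -> mixable U.
Proof.
move=> sepU; have mem_sep x : x \in U ->
    exists2 V, mixable V & (x \in V) && (V \subset U).
  move=> xU; suff [V mV /andP[xV VU]] : exists2 V, mixable V &
      (x \in V) && [forall y in [set: T] :\: U, y \notin V].
    exists V => //; rewrite xV; apply/subsetP => y; apply: contraLR => yU.
    by have /forall_inP := VU; apply; rewrite inE yU inE.
  suff: forall r : seq T, exists2 V, mixable V &
      (x \in V) && all (fun y => (y \notin U) ==> (y \notin V)) r.
    move=> /(_ (enum T))[V mV /andP[xV /allP yV]]; exists V => //; rewrite xV.
    apply/forall_inP => y; rewrite !inE andbT; apply/implyP/yV.
    by rewrite mem_enum.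
  elim=> [|y r [V mV /andP[xV yV]]].
    by exists setT; rewrite ?inE //; apply: mixableT.
  have [yU|yU] := boolP (y \in U); first by exists V; rewrite //= xV yU.
  have [V' mV' /andP[xV' yV']] := sepU x y xU yU.
  exists (V :&: V'); rewrite /= ?inE ?xV ?xV' ?yU ?(negPf yV') ?andbF /=.
    exact: mixableI.
  apply: sub_all yV => z /implyP zV; apply/implyP => /zV; rewrite inE.
  by move=> /negPf ->.
have UE : exists2 V, mixable V & V = U.
  suff: forall r : seq T, exists2 V, mixable V &
      (V \subset U) && all (fun y => (y \in U) ==> (y \in V)) r.
    move=> /(_ (enum T))[V mV /andP[VU /allP UV]]; exists V => //.
    apply/eqP; rewrite eqEsubset VU; apply/subsetP => y yU.
    by have := UV y (mem_enum _ _); rewrite yU.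
  elim=> [|y r [V mV /andP[VU yV]]].
    exists set0; last by rewrite sub0set.
    by rewrite -setCT; apply/mixableC/mixableT.
  have [yU|yU] := boolP (y \in U); last by exists V; rewrite //= VU (negPf yU).
  have [V' mV' /andP[yV' V'U]] := mem_sep y yU.
  exists (V :|: V'); first exact: mixableU.
  rewrite subUset VU V'U /= inE yV' orbT implybT /=.
  by apply: sub_all yV => z /implyP zV; apply/implyP => /zV; rewrite inE => ->.
by case: UE => V mV <-.
Qed.

Lemma mixable_direct_sum (E : {set T}) (S : I -> {set T}) :
  B != set0 -> B \subset powerset E ->
  (forall j, S j != set0) -> (forall i j, i != j -> [disjoint S i & S j]) ->
  \bigcup_j S j = E -> (forall j, mixable (S j)) ->
  direct_sum E B S (fun j => [set J :&: S j | J in B]).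
Proof.
move=> /set0Pn[J0 J0B] BE S0 disj SE mS; split=> // [j|].
  by apply/subsetP => X /imsetP[J _ ->]; rewrite inE subsetIr.
apply/setP => J; apply/idP/imsetP => [JB|[F]].
  exists [ffun j => J :&: S j].
    by rewrite inE; apply/forallP => j; rewrite ffunE; apply/imsetP; exists J.
  have /subsetP/(_ _ JB) := BE; rewrite inE => /setIidPl JE.
  rewrite -{1}JE -SE big_distrr /=; apply: eq_bigr => j _.
  by rewrite ffunE.
rewrite inE => /forallP FB ->.
have FS j : F j \subset S j by have /imsetP[X _ ->] := FB j; apply: subsetIr.
suff [X XB XF] : exists2 X, X \in B & forall j, X :&: S j = F j.
  have /subsetP/(_ _ XB) := BE; rewrite inE => /setIidPl XE.
  suff -> : \bigcup_j F j = X by [].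
  by rewrite -XE -SE big_distrr /=; apply: eq_bigr => j _; rewrite -XF.
(* The prescribed pieces are glued into an arbitrary basis one index at a time; disjointness
   preserves those already in place. *)
suff: forall r : seq I, exists2 X, X \in B & {in r, forall j, X :&: S j = F j}.
  by move=> /(_ (enum I))[X XB XF]; exists X => // j; apply: XF; rewrite mem_enum.
elim=> [|i r [X XB XF]]; first by exists J0.
have /imsetP[Y YB Fi] := FB i.
exists ((Y :&: S i) :|: (X :\: S i)); first exact: mS.
move=> j; rewrite inE; have [-> _|ji /= jr] := eqVneq j i.
  by rewrite Fi; apply/setP => x; rewrite !inE; case: (x \in S i); rewrite ?andbF ?orbF ?andbT.
rewrite -XF //; apply/setP => x; rewrite !inE.
have /pred0P/(_ x)/= := disj _ _ ji.
by case: (x \in S i); case: (x \in S j); rewrite ?andbF ?orbF ?andbT.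
Qed.
End DirectSums.

(** * Stable cyclic intervals and their effect on bases *)

Section Arcs.
Local Open Scope ring_scope.
Variables (n : nat) (n_gt0 : (0 < n)%N).
Implicit Types (a b c d p q : int) (I J S U V : {set 'I_n}) (i j : 'I_n).
Notation res := (res n_gt0).
Notation T := (turns n).

(** The residues of [[p, q)], for [p <= q <= p + n]. *)
Definition arc p q : {set 'I_n} := [set i : 'I_n | T i%:Z p - T i%:Z q == 1].

Lemma turns_window a p q : p <= q <= p + n%:Z -> 0 <= T a p - T a q <= 1.
Proof.
move=> /andP[pq qp]; have := turns_homor n_gt0 a pq; have := turns_homor n_gt0 a qp.
by rewrite turnsDnr //; lia.
Qed.

Lemma mem_arc a p q : (res a \in arc p q) = (T a p - T a q == 1).
Proof.
have FD b : T (b + n%:Z) p - T (b + n%:Z) q = T b p - T b q.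
  by rewrite !turnsDnl //; lia.
by rewrite inE; have /= <- := periodic_res n_gt0 FD a.
Qed.

Lemma mem_arc_lt a p q : p <= q <= p + n%:Z -> p <= a < p + n%:Z ->
  (res a \in arc p q) = (a < q).
Proof.
move=> pq pa; rewrite mem_arc (@turnsP _ n_gt0 a p 0); last by lia.
have := @lt_turns n n_gt0 0 a q; rewrite mul0r addr0 => <-.
have := turns_window a pq; rewrite (@turnsP _ n_gt0 a p 0); last by lia.
by move=> h; apply/eqP/idP; lia.
Qed.

Lemma arcC p q : p <= q <= p + n%:Z -> ~: arc p q = arc q (p + n%:Z).
Proof.
move=> pq; apply/setP => i; rewrite !inE turnsDnr //.
by have := turns_window i%:Z pq => h; apply/eqP/eqP; lia.
Qed.

Lemma card_arc J p q : p <= q <= p + n%:Z ->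
  #|J :&: arc p q|%:Z = cum J q - cum J p.
Proof.
move=> pq; rewrite cumB -sum1_card raddf_sum /=.
rewrite (eq_bigl (fun i => (i \in J) && (i \in arc p q))); last by move=> i; rewrite inE.
rewrite big_mkcondr /=; apply: eq_bigr => i _; rewrite inE.
by have := turns_window i%:Z pq; case: eqP; lia.
Qed.

Lemma cum_setU1 (i : 'I_n) d : cum [set i] (d + 1) - cum [set i] d = (res d == i)%:R.
Proof. by rewrite (cumS n_gt0) inE. Qed.

Variable s : 'S_n.

Definition stable_arc V : Prop :=
  exists p q, [/\ p <= q <= p + n%:Z, V = arc p q & stable s V].

Definition separated i j : Prop :=
  exists2 V, stable_arc V & (i \in V) != (j \in V).

Lemma stable_arcC V : stable_arc V -> stable_arc (~: V).
Proof.
move=> [p [q [pq -> Vs]]]; exists q, (p + n%:Z); split; first by lia.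
  exact: arcC.
exact: stableC.
Qed.

Lemma separatedC i j : separated i j -> separated j i.
Proof. by move=> [V Va ij]; exists V; rewrite // eq_sym. Qed.

Variables (f : int -> int).
Hypotheses (fs : is_lift n_gt0 s f) (fb : bounded n f).
Variable k : nat.
Hypothesis fk : disp f (predT : pred 'I_n) = k%:Z.
Notation r := (rk f [set: 'I_n]).
Notation M := (positroid k s).

Lemma lift_arc V p q a : V = arc p q -> stable s V ->
  (T (f a) p - T (f a) q == 1) = (T a p - T a q == 1).
Proof. by move=> -> Vs; rewrite -!mem_arc fs.2 Vs. Qed.

(** Stability keeps each label and its image on the same side of the arc, so the rank splits at [q]
    label by label. *)
Lemma rk_stable_arc p q c d : p <= q <= p + n%:Z -> stable s (arc p q) ->
  p <= c <= q -> q <= d <= p + n%:Z -> r c q + r q d = r c d.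
Proof.
move=> pq Vs /andP[pc cq] /andP[qd dp]; rewrite /rk -(disp_stable fs q (stableT s)).
rewrite -!sumrB -big_split /=; apply: eq_bigr => i _.
have := lift_arc i%:Z erefl Vs; have := turns_lift_diff n_gt0 fb i%:Z q.
have := turns_window i%:Z pq; have := turns_window (f i%:Z) pq.
have := turns_homor n_gt0 i%:Z pc; have := turns_homor n_gt0 i%:Z cq.
have := turns_homor n_gt0 (f i%:Z) qd; have := turns_homor n_gt0 (f i%:Z) dp.
rewrite turnsDnr //.
move: (T i%:Z p) (T i%:Z q) (T i%:Z c) (T (f i%:Z) p) (T (f i%:Z) q) (T (f i%:Z) d).
move=> Bp Bq Bc Ap Aq Ad; rewrite /posp; clear.
by case: eqP; case: eqP => //; do 3!case: ifP; lia.
Qed.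

Lemma positroid_card J : J \in M -> #|J| = k.
Proof. by rewrite inE => /andP[/eqP]. Qed.

Lemma positroid_le J c d : J \in M -> c <= d <= c + n%:Z -> cum J d - cum J c <= r c d.
Proof. by move=> /(positroidP fs fb fk)[_]; apply. Qed.

(** The elements of [J] in the arc and in its complement are bounded by two ranks that add up to
    [k = #|J|], so both bounds are attained. *)
Lemma positroid_stable_arc p q J : p <= q <= p + n%:Z -> stable s (arc p q) -> J \in M ->
  cum J q - cum J p = r p q.
Proof.
move=> pq Vs JM; apply/eqP; rewrite eq_le positroid_le //=.
have := @positroid_le J q (p + n%:Z) JM ltac:(lia); rewrite cumDn // positroid_card //.
have := @rk_stable_arc p q p (p + n%:Z) pq Vs ltac:(lia) ltac:(lia).
by rewrite rkn // (disp_setT fk); clear; lia.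
Qed.

Lemma cum_mix_in J J' p q c d : p <= q <= p + n%:Z ->
  p <= c <= q -> p <= d <= q ->
  cum ((J :&: arc p q) :|: (J' :\: arc p q)) d - cum ((J :&: arc p q) :|: (J' :\: arc p q)) c
  = cum J d - cum J c.
Proof.
move=> pq /andP[pc cq] /andP[pd dq]; rewrite !cumB [LHS]big_mkcond [RHS]big_mkcond /=.
apply: eq_bigr => i _; rewrite !inE; have := turns_window i%:Z pq.
have := turns_homor n_gt0 i%:Z pc; have := turns_homor n_gt0 i%:Z cq.
have := turns_homor n_gt0 i%:Z pd; have := turns_homor n_gt0 i%:Z dq.
by case: eqP => /= h; rewrite ?andbT ?andbF ?orbF //=; do 2!case: ifP; lia.
Qed.

Lemma mix_setC (J J' U : {set 'I_n}) :
  (J' :&: ~: U) :|: (J :\: ~: U) = (J :&: U) :|: (J' :\: U).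
Proof. by rewrite -setDE [J :\: _]setDE setCK setUC. Qed.

(** A window starting in the arc may stay in it; it may end in the complement, and then its rank is
    the sum of the ranks of its two parts; or it may wrap around. In the last case it contains the
    whole complement, where all bases have equally many elements, so the bound for [J] applies.
    Windows starting outside are treated with the complementary arc. *)
Lemma mixable_stable_arc V : stable_arc V -> mixable M V.
Proof.
have half J J' p q c d : p <= q <= p + n%:Z -> stable s (arc p q) ->
    J \in M -> J' \in M -> p <= c <= q -> c <= d <= c + n%:Z ->
    cum ((J :&: arc p q) :|: (J' :\: arc p q)) d
    - cum ((J :&: arc p q) :|: (J' :\: arc p q)) c <= r c d.
  move=> pq Vs JM J'M pc cd; set K := _ :|: _.
  have Kin c' d' : p <= c' <= q -> p <= d' <= q -> cum K d' - cum K c' = cum J d' - cum J c'.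
    exact: cum_mix_in.
  have qpn : q <= p + n%:Z <= q + n%:Z by lia.
  have Kout c' d' : q <= c' <= p + n%:Z -> q <= d' <= p + n%:Z ->
      cum K d' - cum K c' = cum J' d' - cum J' c'.
    move=> qc qd; by have := cum_mix_in J' J qpn qc qd; rewrite -arcC // mix_setC.
  have Jpq := positroid_stable_arc pq Vs JM; have J'pq := positroid_stable_arc pq Vs J'M.
  have [dq|qd] := lerP d q.
    by rewrite (Kin c d ltac:(lia) ltac:(lia)) positroid_le.
  have [dp|pd] := lerP d (p + n%:Z).
    rewrite -(@rk_stable_arc p q c d pq Vs) //; last by lia.
    have := @positroid_le J c q JM ltac:(lia); have := @positroid_le J' q d J'M ltac:(lia).
    have := Kin c q ltac:(lia) ltac:(lia); have := Kout q d ltac:(lia) ltac:(lia).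
    by clear; lia.
  have [e dE] : exists e, d = e + n%:Z by exists (d - n%:Z); rewrite subrK.
  have := @positroid_le J c d JM cd; apply: le_trans.
  have := Kin c q ltac:(lia) ltac:(lia); have := Kin p e ltac:(lia) ltac:(lia).
  have := Kout q (p + n%:Z) ltac:(lia) ltac:(lia).
  by move: Jpq J'pq; rewrite dE !cumDn // (positroid_card JM) (positroid_card J'M); clear; lia.
move=> [p [q [pq -> Vs]]] J J' JM J'M; set K := _ :|: _.
have cumK c d : p <= c < p + n%:Z -> c <= d <= c + n%:Z -> cum K d - cum K c <= r c d.
  move=> pc cd; have [cq|qc] := lerP c q; first by apply: half => //; lia.
  have -> : K = (J' :&: arc q (p + n%:Z)) :|: (J :\: arc q (p + n%:Z)).
    by rewrite -arcC // mix_setC.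
  apply: half => //; try lia.
  by rewrite -arcC //; apply: stableC.
have KcumD c d : c <= d <= c + n%:Z -> cum K d - cum K c <= r c d.
  move=> cd; pose G a := r a (a + (d - c)) - (cum K (a + (d - c)) - cum K a).
  have GD a : G (a + n%:Z) = G a.
    rewrite /G (_ : a + n%:Z + (d - c) = a + (d - c) + n%:Z); last by lia.
    by rewrite rkD // !cumDn //; lia.
  suff : 0 <= G c by rewrite /G (_ : c + (d - c) = d) ?subr_ge0 //; lia.
  rewrite -(periodic_turns GD c (- T c p)) /G subr_ge0; apply: cumK.
    by have := turns_bounds n_gt0 c p; lia.
  lia.
apply/(positroidP fs fb fk); split=> //.
apply/eqP; rewrite -eqz_nat.
have : cum K q - cum K p = cum J q - cum J p by apply: cum_mix_in; lia.
have qpn : q <= p + n%:Z <= q + n%:Z by lia.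
have := cum_mix_in J' J qpn (c := q) (d := p + n%:Z) ltac:(lia) ltac:(lia).
rewrite -arcC // mix_setC -/K !cumDn // (positroid_card J'M).
have := positroid_stable_arc pq Vs JM; have := positroid_stable_arc pq Vs J'M.
by rewrite -/K; clear -pq; lia.
Qed.

(** From [i] to [i + 1] the necklace loses [i] and gains [s i], so a constant count forces both or
    neither into [V]. *)
Lemma stable_of_necklaces V : (forall i j, #|necklace s i :&: V| = #|necklace s j :&: V|) ->
  stable s V.
Proof.
clear k fk => Vc; pose N a := \sum_(i | s i \in V) (T (f i%:Z) a - T i%:Z a).
have ND a : N (a + n%:Z) = N a.
  by apply: eq_bigr => i _; rewrite !turnsDnr //; lia.
have NE j : N j%:Z = #|necklace s j :&: V|.
  rewrite /N -sum1_card raddf_sum /= [RHS](reindex_inj (@perm_inj _ s)) /=.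
  rewrite [RHS](eq_bigl (fun i => (s i \in V) && (s i \in necklace s j))); last first.
    by move=> i; rewrite inE andbC.
  rewrite big_mkcondr; apply: eq_bigr => i _; rewrite (mem_necklace fs fb).
  by have := turns_lift_diff n_gt0 fb i%:Z j%:Z; case: eqP; lia.
move=> i; have : N i%:Z = N (i%:Z + 1).
  by rewrite (periodic_res n_gt0 ND (_ + 1)) !NE; congr Posz.
have E j : T (f j%:Z) (i%:Z + 1) - T j%:Z (i%:Z + 1)
    = T (f j%:Z) i%:Z - T j%:Z i%:Z - (s j == i)%:R + (j == i)%:R.
  have := turns_succ n_gt0 (f j%:Z) i%:Z; have := turns_succ n_gt0 j%:Z i%:Z.
  rewrite fs.2 !res_ord; move: (_%:R : int) (_%:R : int) => x y <- <-; lia.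
rewrite {2}/N (eq_bigr _ (fun j _ => E j)) big_split sumrB /= -/(N i%:Z).
have -> : \sum_(j | s j \in V) ((j == i)%:R : int) = (s i \in V)%:R.
  rewrite big_mkcond /= (bigD1 i) //= eqxx big1 ?addr0.
    by case: (s i \in V).
  by move=> j /negPf ->; case: ifP.
have -> : \sum_(j | s j \in V) ((s j == i)%:R : int) = (i \in V)%:R.
  rewrite big_mkcond /= (bigD1 ((s^-1)%g i)) //= permKV eqxx big1 ?addr0.
    by case: (i \in V).
  move=> j ji; case: (s j =P i) => [sj|]; last by case: ifP.
  by rewrite -sj permK eqxx in ji.
by case: (s i \in V); case: (i \in V); lia.
Qed.
End Arcs.

(** * Connected components in terms of separating intervals *)

Section Components.
Local Open Scope ring_scope.
Variables (n : nat) (n_gt0 : (0 < n)%N).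
Implicit Types (a b c d p q w : int) (I J S U V : {set 'I_n}) (i j x y : 'I_n).
Notation res := (res n_gt0).
Notation T := (turns n).

(** Hermite's identity: raising [w] by one removes the first floor and appends the same floor plus
    one. *)
Lemma sum_floor w : \sum_(i < n) T (w + i%:Z) 0 = w.
Proof.
pose H v := \sum_(i < n) T (v + i%:Z) 0.
have HS v : H (v + 1) = H v + 1.
  have := @big_ord_recr int 0 +%R n (fun i : 'I_n.+1 => T (v + i%:Z) 0).
  rewrite big_ord_recl /= addr0 turnsDnl // => h.
  apply: (@addrI _ (T v 0)); rewrite [RHS]addrA [T v 0 + H v]addrC -[RHS]addrA -h.
  by congr (_ + _); apply: eq_bigr => i _; rewrite /bump -addrA -PoszD.
have H0 : H 0 = 0 by rewrite /H big1 // => i _; rewrite add0r turns_ord.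
rewrite -/(H w); elim: w => [//|m IH|m IH]; first by rewrite -addn1 PoszD HS IH.
by apply: (@addIr _ 1); rewrite -HS (_ : - (m.+1)%:Z + 1 = - m%:Z) ?IH //; lia.
Qed.

Lemma turns0_le w w' q : w' <= w + q * n%:Z -> T w' 0 <= T w 0 + q.
Proof. by move=> h; rewrite -turnsDl //; apply: turns_homol. Qed.

Lemma increments_cum (F : int -> int) J c d : (forall a, F (a + 1) - F a = (res a \in J)%:R) ->
  c <= d -> cum J d - cum J c = F d - F c.
Proof.
move=> FJ cd; have [m ->] : exists m : nat, d = c + m%:Z.
  by exists `|d - c|%N; lia.
elim: m => [|m IH]; first by rewrite addr0 !subrr.
have := FJ (c + m%:Z); rewrite -(cumS n_gt0).
by rewrite (_ : c + m.+1%:Z = c + m%:Z + 1); [move: IH; clear; lia | lia].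
Qed.

Variables (s : 'S_n) (f : int -> int).
Hypotheses (fs : is_lift n_gt0 s f) (fb : bounded n f).
Variable k : nat.
Hypothesis fk : disp f (predT : pred 'I_n) = k%:Z.
Notation r := (rk f [set: 'I_n]).
Notation M := (positroid k s).

Lemma rk_succ d : r d (d + 1) <= 1.
Proof.
rewrite (rkE fs d (d + 1) (stableT s)).
have one : \sum_i ((s i == res d)%:R : int) = 1.
  rewrite (bigD1 ((s^-1)%g (res d))) //= permKV eqxx big1 ?addr0 // => i ij.
  by case: (s i =P res d) => // si; rewrite -si permK eqxx in ij.
rewrite -[leRHS]one big_mkcond /=; apply: ler_sum => i _; rewrite inE.
have := turns_succ n_gt0 (f i%:Z) d; rewrite fs.2 res_ord.
have := turns_lift_diff n_gt0 fb i%:Z d.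
move: (T (f i%:Z) d) (T (f i%:Z) _) (T i%:Z d) => A B C.
by move: (_%:R : int) => b; rewrite /posp; case: ifP => h; clear -h; lia.
Qed.

(* Averaging the necklaces gives a point of the matroid polytope at which only
   the constraints of stable arcs are tight, hence it can be moved a little in
   the direction e_x - e_y; rounding splits a multiple of the moved point into
   bases, one of which has more than its share of elements of [U]. *)
Lemma const_card_separated U x y :
  (forall J J', J \in M -> J' \in M -> #|J :&: U| = #|J' :&: U|) ->
  x \in U -> y \notin U -> separated s x y.
Proof.
move=> Uc xU yU; apply: contrapT => nsep.
have nsepV V : stable_arc s V -> (x \in V) = (y \in V).
  by move=> Va; apply: contrapT => /eqP xy; apply: nsep; exists V.
have NM j : necklace s j \in M := necklace_positroid fs fb fk j.
(* The necklaces are summed instead of averaged, so [W] counts [n] times the moved point and the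
   displacement along [e_x - e_y] has size [1 / n]. *)
pose W d := \sum_j cum (necklace s j) d + cum [set x] d - cum [set y] d.
have WB c d : W d - W c = \sum_j (cum (necklace s j) d - cum (necklace s j) c)
    + (cum [set x] d - cum [set x] c) - (cum [set y] d - cum [set y] c).
  rewrite sumrB /W; move: (\sum_j cum _ d) (\sum_j cum _ c) => A B; lia.
have WD d : W (d + n%:Z) = W d + k%:Z * n%:Z.
  rewrite /W !cumDn // !cards1 (eq_bigr (fun j => cum (necklace s j) d + k%:Z)).
    rewrite big_split /= sumr_const card_ord -mulr_natr natz.
    by move: (\sum_j cum _ d) => A; lia.
  by move=> j _; rewrite cumDn // (card_necklaceT fs fb fk).
have Wle c d : c <= d <= c + n%:Z -> W d - W c <= r c d * n%:Z.
  move=> cd; rewrite WB.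
  have le1 j : cum (necklace s j) d - cum (necklace s j) c <= r c d.
    exact: (positroid_le fs fb fk (NM j)).
  have E (z : 'I_n) : cum [set z] d - cum [set z] c = (z \in arc n c d)%:R.
    rewrite -card_arc //; case: (boolP (z \in _)) => h.
      by rewrite (setIidPl _) ?cards1 // sub1set.
    by rewrite disjoint_setI0 ?cards0 // disjoints1.
  rewrite !E; have [/nsepV ->|nst] := pselect (stable_arc s (arc n c d)).
    rewrite addrK; apply: le_trans (ler_sum _ (fun j _ => le1 j)) _.
    by rewrite sumr_const card_ord -mulr_natr natz.
  (* If every necklace were tight on this arc, all would meet it in the same number of elements and
     the arc would be stable. One unit of slack is enough to absorb the perturbation. *)
  have [j0 lt1] : exists j, cum (necklace s j) d - cum (necklace s j) c < r c d.
    apply: contrapT => /forallNP h; apply: nst; exists c, d; split=> //.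
    apply: (stable_of_necklaces fs fb) => i j; apply/eqP; rewrite -eqz_nat.
    have e l : cum (necklace s l) d - cum (necklace s l) c = r c d.
      by apply/eqP; rewrite eq_le le1 /= leNgt; apply/negP/h.
    by rewrite !card_arc // !e.
  have : \sum_j (cum (necklace s j) d - cum (necklace s j) c) <= r c d * n%:Z - 1.
    have -> : r c d * n%:Z - 1 = \sum_(j < n) (r c d - (j == j0)%:R).
      rewrite sumrB sumr_const card_ord -mulr_natr natz; congr (_ - _).
      by rewrite (bigD1 j0) //= eqxx big1 ?addr0 // => j /negPf ->.
    apply: ler_sum => j _; case: eqP => [->|_]; last by rewrite subr0 le1.
    by move: lt1; rewrite -ltzD1; clear; lia.
  have step (A B : int) (u v : bool) : A <= B - 1 -> A + u%:R - v%:R <= B.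
    by case: u; case: v; lia.
  exact: step.
have WS_ge0 d : 0 <= W (d + 1) - W d.
  rewrite WB !cum_setU1 // (eq_bigr (fun j => (res d \in necklace s j)%:R)); last first.
    by move=> j _; rewrite (cumS n_gt0).
  have pos : 0 <= \sum_(j < n) ((res d \in necklace s j)%:R : int).
    by apply: sumr_ge0 => j _; case: (_ \in _).
  case: (eqVneq (res d) y) => [dy|_]; last first.
    have step (A : int) (u : bool) : 0 <= A -> 0 <= A + u%:R - 0 by case: u; lia.
    exact: step.
  (* [y] belongs to its own necklace, so the coordinate that is lowered stays nonnegative. *)
  have : 1 <= \sum_(j < n) ((res d \in necklace s j)%:R : int).
    rewrite (bigD1 y) //= dy.
    have -> : y \in necklace s y.
      rewrite inE /cyc_le [cyc_pos y y](_ : _ = 0%N) //.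
      by rewrite /cyc_pos subnKC ?modnn // ltnW.
    by rewrite lerDl; apply: sumr_ge0 => j _; case: (_ \in _).
  have step (A : int) (u : bool) : 1 <= A -> 0 <= A + u%:R - 1 by case: u; lia.
  exact: step.
(* Up to a constant, [F i] is the counting function of the basis [K i] below; by [sum_floor] the
   [F i] add up to [W]. *)
pose F i d := T (W d + i%:Z) 0.
have FSS i d : 0 <= F i (d + 1) - F i d <= 1.
  have h1 : F i d <= F i (d + 1) + 0.
    by apply: turns0_le; have := WS_ge0 d; lia.
  have h2 : F i (d + 1) <= F i d + 1.
    have d1 : d <= d + 1 <= d + n%:Z by have := n_gt0; lia.
    apply: le_trans (turns0_le _) (_ : F i d + r d (d + 1) <= _).
      by have := Wle d (d + 1) d1; lia.
    by rewrite lerD2l rk_succ.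
  by apply/andP; split; lia.
have FD i d : F i (d + n%:Z) = F i d + k%:Z.
  by rewrite /F WD addrAC turnsDl.
pose K (i : 'I_n) := [set e : 'I_n | F i (e%:Z + 1) - F i e%:Z == 1].
have FK (i : 'I_n) a : F i (a + 1) - F i a = (res a \in K i)%:R.
  have GD b : F i (b + n%:Z + 1) - F i (b + n%:Z) = F i (b + 1) - F i b.
    by rewrite (_ : b + n%:Z + 1 = b + 1 + n%:Z) ?FD; [clear; lia | lia].
  have := periodic_res n_gt0 GD a => /= ->; rewrite inE.
  have step (z : int) : 0 <= z <= 1 -> z = (z == 1)%:R by case: eqP; lia.
  exact/step/FSS.
have KM (i : 'I_n) : K i \in M.
  apply/(positroidP fs fb fk); split.
    have h : (0 : int) <= 0 + n%:Z by lia.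
    have := increments_cum (FK i) h; rewrite FD cumDn // addrAC subrr add0r.
    by rewrite addrAC subrr add0r => -[].
  move=> c d cd; rewrite (increments_cum (FK i)); last by case/andP: cd.
  rewrite lerBlDl; apply: turns0_le; have := Wle c d cd; lia.
have cardU J : #|J :&: U|%:Z = \sum_(e in U) ((e \in J)%:R : int).
  rewrite -sum1_card raddf_sum /= (eq_bigl (fun e => (e \in U) && (e \in J))).
    by rewrite big_mkcondr; apply: eq_bigr => e _; case: (e \in J).
  by move=> e; rewrite inE andbC.
pose kap := #|necklace s x :&: U|%:Z.
have kapE J : J \in M -> #|J :&: U|%:Z = kap by move=> JM; rewrite /kap (Uc _ _ (NM x) JM).
have : \sum_(i < n) #|K i :&: U|%:Z = \sum_(j < n) #|necklace s j :&: U|%:Z + 1.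
  under eq_bigr do rewrite cardU; under [in RHS]eq_bigr do rewrite cardU.
  rewrite exchange_big [in RHS]exchange_big /=.
  have one : \sum_(e in U) ((e == x)%:R - (e == y)%:R : int) = 1.
    rewrite sumrB (bigD1 x) //= eqxx big1; last by move=> e /andP[_ /negPf ->].
    rewrite big1 ?subr0 ?addr0 // => e eU.
    by case: eqP => // ey; rewrite -ey eU in yU.
  rewrite -[X in _ = _ + X]one -big_split /=; apply: eq_bigr => e _.
  transitivity (W (e%:Z + 1) - W e%:Z).
    rewrite -(sum_floor (W (e%:Z + 1))) -(sum_floor (W e%:Z)) -sumrB.
    by apply: eq_bigr => i _; rewrite -[e in LHS](res_ord n_gt0) -FK.
  rewrite WB !cum_setU1 // res_ord addrA; congr (_ + _ - _).
  by apply: eq_bigr => j _; rewrite (cumS n_gt0) res_ord.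
rewrite (eq_bigr (fun=> kap)) => [|i _]; last exact: kapE.
rewrite [in RHS](eq_bigr (fun=> kap)) => [|i _]; last exact: kapE.
by move/eqP; rewrite -subr_eq0 opprD addrA subrr.
Qed.

Lemma mixable_summand (I : finType) (S : I -> {set 'I_n}) BB (i : I) V :
  direct_sum [set: 'I_n] M S BB -> stable_arc s V -> mixable (BB i) (S i :&: V).
Proof.
move=> dsum Va J J' Ji J'i; have NM := necklace_positroid fs fb fk (res 0).
have := mixable_stable_arc fs fb fk Va
  (direct_sum_replace dsum Ji NM) (direct_sum_replace dsum J'i NM).
move=> /(direct_sum_restr dsum i).
rewrite [X in X \in _](_ : _ = J :&: (S i :&: V) :|: J' :\: (S i :&: V)) //.
apply/setP => x.
have [_ _ _ /(_ i)/subsetP BBS _] := dsum.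
have JS : (x \in J) ==> (x \in S i).
  by apply/implyP; have := BBS _ Ji; rewrite inE => /subsetP; apply.
have JS' : (x \in J') ==> (x \in S i).
  by apply/implyP; have := BBS _ J'i; rewrite inE => /subsetP; apply.
rewrite !inE; move: JS JS'.
by case: (x \in S i); case: (x \in J); case: (x \in J'); case: (x \in V);
  rewrite /= ?andbF ?andbT ?orbF.
Qed.

(** Summands meet all bases equally often, which separates their labels from the others; stable arcs
    are mixable, so they split any set containing two separated labels. The result is a criterion on
    pairs of labels, the form that conjugation can transport. *)
Lemma component_separated (I : finType) (S : I -> {set 'I_n}) :
  component_ground_sets M S <->
  [/\ forall i : I, S i != finset.set0, forall i j : I, i != j -> [disjoint S i & S j],
     \bigcup_i S i = [set: 'I_n] &
     forall (i j : I) x y, x \in S i -> y \in S j -> separated s x y <-> i <> j].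
Proof.
have Mcard J : J \in M -> #|J| = k by apply: positroid_card.
have NM := necklace_positroid fs fb fk (res 0).
split.
  case=> BB dsum conn; have [S0 disj SE BBS ME] := dsum; split=> // i j x y xi yj.
  split; last first.
    move=> ij; apply: (@const_card_separated (S i)) => //.
      by move=> J J'; apply: (direct_sum_card dsum i Mcard).
    apply/negP => yi; have /eqP/disj/pred0P/(_ y)/= := ij.
    by rewrite yi yj.
  case=> V Va xy ij; subst j; apply: (conn i).
  pose P (b : bool) := S i :&: (if b then V else ~: V).
  exists P; exists (fun b : bool => [set J :&: P b | J in BB i]); apply: mixable_direct_sum.
  - by apply/set0Pn; exists (necklace s (res 0) :&: S i); apply: direct_sum_restr NM.
  - exact: BBS.
  - move=> b; apply/set0Pn; move: xy; rewrite /P.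
    case xV: (x \in V); case yV: (y \in V) => // _; case: b;
      by [exists x; rewrite !inE xi xV | exists y; rewrite !inE yj yV].
  - move=> b b'; rewrite -setI_eq0 -subset0 /P; case: b; case: b' => //= _;
      by apply/subsetP => z; rewrite !inE; case: (z \in V); rewrite ?andbF.
  - apply/setP => z; apply/bigcupP/idP => [[b _]|zi]; first by rewrite inE => /andP[].
    by exists (z \in V) => //; rewrite inE zi; case: ifP => zV; rewrite ?inE zV.
  - move=> b; apply: mixable_summand dsum _; case: b => //.
    exact: stable_arcC.
move=> [S0 disj SE sepS]; pose BB (i : I) := [set J :&: S i | J in M].
have mS (i : I) : mixable M (S i).
  apply: mixable_sep => x y xi yi; have : y \in [set: 'I_n] by rewrite inE.
  rewrite -SE => /bigcupP[j _ yj].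
  have [ij|] := (sepS i j x y xi yj).2; first by rewrite ij yj in yi.
  move=> V Va; case xV: (x \in V); case yV: (y \in V) => // _.
    by exists V; rewrite ?xV ?yV //; apply: (mixable_stable_arc fs fb fk).
  exists (~: V); rewrite ?inE ?xV ?yV //.
  by apply/mixableC/(mixable_stable_arc fs fb fk).
have dsum : direct_sum [set: 'I_n] M S BB.
  apply: mixable_direct_sum => //; first by apply/set0Pn; exists (necklace s (res 0)).
  by apply/subsetP => J _; rewrite inE subsetT.
exists BB => // i [P [BB' dsum']].
have [P0 Pdisj PS _ _] := dsum'.
have Pin (b : bool) x : x \in P b -> x \in S i by rewrite -PS => xb; apply/bigcupP; exists b.
have [[x xP] [y yP]] := (set0Pn _ (P0 true), set0Pn _ (P0 false)).
have [] := (sepS i i x y (Pin _ _ xP) (Pin _ _ yP)).1; last by [].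
apply: (@const_card_separated (P true)) => //; last first.
  by apply/negP => yP'; have /pred0P/(_ y)/= := Pdisj true false isT; rewrite yP yP'.
move=> J J' JM J'M.
have inP K : K :&: P true = (K :&: S i) :&: P true.
  rewrite -setIA; congr (_ :&: _); apply/esym/setIidPr/subsetP => z; apply: Pin.
have BBc K : K \in BB i -> #|K| = #|J :&: S i|.
  by case/imsetP => L LM ->; apply: (direct_sum_card dsum i Mcard).
rewrite inP [in RHS]inP; apply: (direct_sum_card dsum' true BBc); exact: imset_f.
Qed.
End Components.

(** * The inversion count of a stable set, and crossing chords *)

Section Crossings.
Local Open Scope ring_scope.
Variables (n : nat) (n_gt0 : (0 < n)%N).
Implicit Types (a b c d p q w x y : int) (I J S U V : {set 'I_n}) (i j : 'I_n).
Notation res := (res n_gt0).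
Notation T := (turns n).

(** In each period starting at [p] the arc comes first, so the periods containing [x] and [y]
    determine the floor. *)
Lemma turns_arc p q x y : p <= q <= p + n%:Z ->
  res x \in arc n p q -> res y \notin arc n p q -> T x y = T x p - T y p - 1.
Proof.
move=> pq; rewrite !mem_arc => /eqP hx hy; have := turns_window n_gt0 y pq.
move=> hy'; have {hy hy'} hy : T y q = T y p by move: hy; case: eqP => //; lia.
have {}hx : T x q = T x p - 1 by lia.
apply: turnsP => //; have := turns_bounds n_gt0 x p; have := turns_bounds n_gt0 y p.
have := turns_bounds n_gt0 x q; have := turns_bounds n_gt0 y q; rewrite hx hy.
by move: (T x p) (T y p) => u v; clear; lia.
Qed.

Variables (s : 'S_n) (f : int -> int).
Hypotheses (fs : is_lift n_gt0 s f) (fb : bounded n f).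

(** A pair contributes 1 exactly when the chord of [i] passes over [p] and that of [j] does not.
    These are independent conditions, hence the product. *)
Lemma inv_count_arc V : stable_arc s V ->
  inv_count f (mem V) (mem (~: V)) =
    disp f (mem V) * (#|~: V|%:Z - disp f (mem (~: V))).
Proof.
move=> [p [q [pq VE Vs]]]; rewrite -!(disp_stable fs p) //; last exact: stableC.
rewrite -sum1_card raddf_sum -sumrB /inv_count mulr_suml /=.
apply: eq_bigr => i iV; rewrite mulr_sumr; apply: eq_bigr => j jV.
have hi : res i%:Z \in arc n p q by rewrite res_ord -VE.
have hj : res j%:Z \notin arc n p q by rewrite res_ord -VE -in_setC.
have hfi : res (f i%:Z) \in arc n p q by rewrite fs.2 res_ord -VE Vs.
have hfj : res (f j%:Z) \notin arc n p q by rewrite fs.2 res_ord -VE -in_setC (stableC Vs).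
rewrite (turns_arc pq hi hj) (turns_arc pq hfi hfj).
have := turns_lift_diff n_gt0 fb i%:Z p; have := turns_lift_diff n_gt0 fb j%:Z p.
move: (T _ p) (T _ p) (T _ p) (T _ p) => A B C D; rewrite /posp => h1 h2.
have [[e1 ->] | [e1 ->]] : (D = C /\ 1%:Z - (D - C) = 1) \/ (D = C + 1 /\ 1%:Z - (D - C) = 0).
  by clear -h1; lia.
  by rewrite e1 mulr1; case: ifP; lia.
by rewrite e1 mulr0; case: ifP; lia.
Qed.

Lemma cum_necklace_at S a d : stable s S -> a <= d <= a + n%:Z ->
  cum (necklace s (res a) :&: S) d - cum (necklace s (res a) :&: S) a = rk f S a d.
Proof.
move=> Ss ad; set j := res a; have aE := res_eq n_gt0 a; rewrite -/j in aE.
pose q := T a 0; pose d' := d - q * n%:Z; have dE : d = d' + q * n%:Z by rewrite subrK.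
have jd : j%:Z <= d' <= j%:Z + n%:Z by rewrite /d' /q; lia.
pose F x := rk f S x (x + (d - a)).
have FD x : F (x + n%:Z) = F x.
  by rewrite /F (_ : x + n%:Z + (d - a) = x + (d - a) + n%:Z) ?rkD //; lia.
have := periodic_res n_gt0 FD a; rewrite /F (_ : a + (d - a) = d); last by lia.
rewrite -/j (_ : j%:Z + (d - a) = d') => [->|]; last by rewrite /d' /q; lia.
rewrite -(cum_necklace fs fb) // {1}dE {1}aE -/q !cumD //; lia.
Qed.

(** The chords from [x] to [f x] and from [y] to [f y] cross. *)
Definition crosses x y : bool := [&& f y - n%:Z < x, x < y, y < f x & f x < f y].

(* The count makes every bound [cum_necklace_le] tight on the windows [[y, f y)]
   with [y] outside [S]; a crossing would make one of them strict. *)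
Lemma not_crosses_of_count S : stable s S ->
  inv_count f (mem S) (mem (~: S)) =
    disp f (mem S) * (#|~: S|%:Z - disp f (mem (~: S))) ->
  forall x y, res x \in S -> res y \notin S -> ~~ crosses x y.
Proof.
move=> Ss cnt; have Sc := stableC Ss.
have eq_rk j i : i \notin S ->
    cum (necklace s j :&: S) (f i%:Z) - cum (necklace s j :&: S) i%:Z = rk f S i%:Z (f i%:Z).
  move=> iS; set B := necklace s j :&: S.
  have sum_rk : \sum_(i in ~: S) rk f S i%:Z (f i%:Z) = disp f (mem S) * disp f (mem (~: S)).
    rewrite sumrB sumr_const /= -mulr_natr natz.
    move: cnt; rewrite /inv_count exchange_big /= => ->.
    by rewrite mulrBr opprB addrC subrK.
  (* Subtracting a multiple of the floor makes [cum B] periodic, and the variation of a periodic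
     function along all chords of a stable set sums to zero. *)
  have sum_cum : \sum_(i in ~: S) (cum B (f i%:Z) - cum B i%:Z)
      = disp f (mem S) * disp f (mem (~: S)).
    pose F x := cum B x - #|B|%:Z * T x 0.
    have FD x : F (x + n%:Z) = F x.
      by rewrite /F cumDn // turnsDnl // mulrDr mulr1; lia.
    have := sum_lift (mem (~: S)) fs FD; rewrite (eq_bigl (mem (~: S))) => [e|l]; last exact: Sc.
    rewrite -(card_necklace fs fb j Ss) -/B [disp _ (mem (~: S))]/disp mulr_sumr.
    apply/eqP; rewrite -subr_eq0 -sumrB.
    rewrite (eq_bigr (fun i : 'I_n => F (f i%:Z) - F i%:Z)).
      by rewrite sumrB e subrr.
    by move=> l _; rewrite /F mulrBr; lia.
  have ge0 l : l \in ~: S -> 0 <= rk f S l%:Z (f l%:Z) - (cum B (f l%:Z) - cum B l%:Z).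
    move=> _; rewrite subr_ge0; apply: (cum_necklace_le fs fb) => //.
    by have /andP[/ltW -> ->] := fb l%:Z.
  have : \sum_(l in ~: S) (rk f S l%:Z (f l%:Z) - (cum B (f l%:Z) - cum B l%:Z)) = 0.
    by rewrite sumrB sum_rk sum_cum subrr.
  by move/(psumr_eq0P ge0)/(_ i); rewrite inE iS => /(_ isT)/eqP; rewrite subr_eq0 => /eqP.
move=> x y xS yS; apply/negP => /and4P[h1 h2 h3 h4].
pose a := f y - n%:Z; have aE : f y = a + n%:Z by rewrite subrK.
have eq_y : cum (necklace s (res a) :&: S) (f y) - cum (necklace s (res a) :&: S) y
    = rk f S y (f y).
  pose F z := cum (necklace s (res a) :&: S) (f z) - cum (necklace s (res a) :&: S) z
    - rk f S z (f z).
  have FD z : F (z + n%:Z) = F z by rewrite /F fs.1 rkD // !cumDn //; lia.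
  apply/eqP; rewrite -subr_eq0 -/(F y) (periodic_res n_gt0 FD) /F.
  by rewrite eq_rk // subrr.
have fby := fb y.
have ya : a <= y <= a + n%:Z by rewrite /a; lia.
have aa : a <= a + n%:Z <= a + n%:Z by lia.
have rk_y := cum_necklace_at Ss ya; have rk_a := cum_necklace_at Ss aa.
have sum0 : rk f S a y + rk f S y (a + n%:Z) = disp f (mem S).
  by rewrite -(rkn n_gt0 fb S a) -rk_y -rk_a -aE -eq_y; lia.
(* The contribution of [z] to the defect of submodularity for [[a, y)] and [[y, a + n)]; by [sum0]
   the total defect is zero. *)
pose t z := T (f z) y - T z y - (posp (T (f z) y - T z a) + posp (T (f z) (a + n%:Z) - T z y)).
have t_ge0 i : i \in S -> 0 <= t i%:Z.
  move=> _; rewrite /t turnsDnr //; have [ay yan] := andP ya.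
  have := turns_homor n_gt0 i%:Z ay; have := turns_homor n_gt0 i%:Z yan.
  have := turns_homor n_gt0 (f i%:Z) ay; have := turns_homor n_gt0 (f i%:Z) yan.
  have := turns_lift_diff n_gt0 fb i%:Z y; have := turns_lift_diff n_gt0 fb i%:Z a.
  rewrite !turnsDnr //.
  move: (T _ a) (T _ a) (T _ y) (T _ y) => A B C D; rewrite /posp; clear.
  by do 2!case: ifP; lia.
have sum_t : \sum_(i in S) t i%:Z = 0.
  rewrite sumrB (disp_stable fs y Ss) big_split /=.
  have step (A B C : int) : A - B + (A - C) = A -> A - (B + C) = 0 by lia.
  exact: step sum0.
have tD z : t (z + n%:Z) = t z.
  rewrite /t fs.1 !turnsDnl //; congr (_ - (posp _ + posp _)); lia.
have : t x = 0 by rewrite (periodic_res n_gt0 tD); apply: (psumr_eq0P t_ge0 sum_t).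
(* A crossing means [a < x < y < f x < a + n], which gives [t x = 1]. *)
rewrite /t turnsDnr // (@turnsP _ n_gt0 (f x) y 0); last by rewrite /a in ya h1 *; lia.
rewrite (@turnsP _ n_gt0 x y (-1)); last by lia.
rewrite (@turnsP _ n_gt0 x a 0); last by rewrite /a; lia.
rewrite (@turnsP _ n_gt0 (f x) a 0); last by rewrite /a; lia.
by [].
Qed.
End Crossings.

(** * Separating intervals obtained from noncrossing stable sets *)

Section Noncrossing.
Local Open Scope ring_scope.
Variables (n : nat) (n_gt0 : (0 < n)%N).
Implicit Types (a b p q v w x y : int) (S U V : {set 'I_n}) (i j : 'I_n).
Notation res := (res n_gt0).
Notation T := (turns n).
Variables (s : 'S_n) (f : int -> int).
Hypotheses (fs : is_lift n_gt0 s f) (fb : bounded n f).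
Notation crosses := (crosses n f).

Lemma stable_of_subset V : (forall i, i \in V -> s i \in V) -> stable s V.
Proof.
move=> Vs i; apply/idP/idP => [|/Vs//].
have /eqP sV : s @: V == V.
  rewrite eqEcard card_imset ?leqnn ?andbT; last exact: perm_inj.
  by apply/subsetP => _ /imsetP[j /Vs jV ->].
by rewrite -{1}sV => /imsetP[j jV /perm_inj ->].
Qed.

Lemma res_stable S a : stable s S -> (res (f a) \in S) = (res a \in S).
Proof. by move=> Ss; rewrite fs.2 Ss. Qed.

Lemma crossesD x y q : crosses (x + q * n%:Z) (y + q * n%:Z) = crosses x y.
Proof.
rewrite /crosses !(is_liftD fs) ; congr [&& _, _, _ & _]; rewrite ?ltrD2r //.
by rewrite addrAC ltrD2r.
Qed.

Definition noncrossing S : Prop :=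
  forall x y, (res x \in S) != (res y \in S) -> ~~ crosses x y.

(** Let [(p, q)] be the gap of [S + n Z] around [j]. A chord starting in the gap has all elements of
    [S] on one side, so it ends before [q] or beyond [p + n], that is, again in the gap modulo
    [n]. *)
Lemma separated_gap S i j : stable s S -> i \in S -> j \notin S ->
  (forall v, res v \notin S ->
     (forall u, res u \in S -> v < u < v + n%:Z -> u < f v) \/
     (forall u, res u \in S -> v < u < v + n%:Z -> f v < u)) ->
  separated s i j.
Proof.
move=> Ss iS jS side.
have notj a : res a \in S -> a <> j%:Z.
  by move=> aS aj; rewrite aj res_ord (negPf jS) in aS.
have [d dS dmin] : exists2 d : nat, res (j%:Z + d%:Z) \in S &
    forall e : nat, res (j%:Z + e%:Z) \in S -> (d <= e)%N.
  have ex : exists d : nat, res (j%:Z + d%:Z) \in S.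
    exists (i + n - j)%N; rewrite (_ : _ + _ = i%:Z + n%:Z) ?resDn ?res_ord //.
    by have := ltn_ord j; lia.
  by case: (ex_minnP ex) => d dS dmin; exists d.
have [d' d'S d'min] : exists2 d : nat, res (j%:Z - d%:Z) \in S &
    forall e : nat, res (j%:Z - e%:Z) \in S -> (d <= e)%N.
  have ex : exists d : nat, res (j%:Z - d%:Z) \in S.
    exists (j + n - i)%N; rewrite -(resDn n_gt0) (_ : _ + _ = i%:Z) ?res_ord //.
    by have := ltn_ord i; lia.
  by case: (ex_minnP ex) => e eS emin; exists e.
pose p : int := j%:Z - d'%:Z; pose q : int := j%:Z + d%:Z.
have d_gt0 : (0 < d)%N by have := notj _ dS; lia.
have d'_gt0 : (0 < d')%N by have := notj _ d'S; lia.
have d'n : (d' < n)%N.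
  rewrite ltnNge; apply/negP => nd'; have := d'min (d' - n)%N.
  rewrite -(resDn n_gt0 (j%:Z - d'%:Z)) in d'S.
  by rewrite (_ : j%:Z - (d' - n)%N%:Z = j%:Z - d'%:Z + n%:Z) => [/(_ d'S)|]; lia.
have qpn : q <= p + n%:Z.
  have := dmin (n - d')%N; rewrite (_ : _ + (n - d')%N%:Z = p + n%:Z); last by rewrite /p; lia.
  by rewrite resDn => /(_ d'S); rewrite /p /q; lia.
have gapS v : p < v < q -> res v \notin S.
  move=> pvq; apply/negP => vS; have [vj|jv] := lerP v j%:Z.
    have := d'min `|j%:Z - v|%N; rewrite (_ : j%:Z - _ = v) => [/(_ vS)|]; rewrite /p /q in pvq; lia.
  have := dmin `|v - j%:Z|%N; rewrite (_ : j%:Z + _ = v) => [/(_ vS)|]; rewrite /p /q in pvq; lia.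
have pq1 : p + 1 <= q <= p + 1 + n%:Z by move: d_gt0 d'_gt0 qpn; rewrite /p /q; clear; lia.
have arcP (x : 'I_n) : x \in arc n (p + 1) q <-> exists2 v, p < v < q & res v = x.
  split=> [xV|[v pvq <-]]; last first.
    by rewrite mem_arc_lt //; move: qpn; clear -pvq; lia.
  pose v : int := x%:Z - T x%:Z (p + 1) * n%:Z.
  have rv : res v = x by rewrite /v -mulNr resD res_ord.
  have pv : p + 1 <= v < p + 1 + n%:Z.
    by have := turns_bounds n_gt0 x%:Z (p + 1); rewrite /v; clear; lia.
  exists v => //; move: xV; rewrite -rv mem_arc_lt //; clear -pv; lia.
exists (arc n (p + 1) q).
  exists (p + 1), q; split=> //; apply: stable_of_subset => x /arcP[v pvq <-].
  apply/arcP; have vS := gapS v pvq; have fvb := fb v.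
  have fvS : res (f v) \notin S by rewrite res_stable.
  have pn : p < v < p + n%:Z by clear -pvq qpn; lia.
  have [/(_ (p + n%:Z))|/(_ q)] := side v vS.
    rewrite resDn => /(_ d'S) h; exists (f v - n%:Z); last first.
      by rewrite -(resDn n_gt0) subrK fs.2.
    by clear -h pn pvq fvb; lia.
  move=> /(_ dS) h; exists (f v); last by rewrite fs.2.
  by clear -h pn pvq fvb qpn; lia.
have -> : j \in arc n (p + 1) q.
  apply/arcP; exists j%:Z; last by rewrite res_ord.
  by rewrite /p /q; clear -d_gt0 d'_gt0; lia.
have -> // : (i \in arc n (p + 1) q) = false.
by apply/negP => /arcP[v /gapS vS vi]; rewrite vi iS in vS.
Qed.

(** Chords of [S] do not cross the chord from [v] to [f v], so those starting in [L] end in [L].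
    Chords of [L] and of [S :\: L] lie on opposite sides of it and cannot cross each other. *)
Lemma noncrossing_side S v : stable s S -> noncrossing S -> res v \notin S ->
  let L := S :&: arc n (v + 1) (f v) in
  [/\ stable s L, noncrossing L & noncrossing (S :\: L)].
Proof.
move=> Ss NS vS L; have fvS : res (f v) \notin S by rewrite res_stable.
have fvb := fb v; have v1 : v + 1 <= f v <= v + 1 + n%:Z by clear -fvb; lia.
have neS a b : res a \in S -> res b \notin S -> a <> b.
  by move=> aS bS ab; rewrite ab (negPf bS) in aS.
have inL a : res a \in S -> v < a < v + n%:Z -> (res a \in L) = (a < f v).
  move=> aS va; rewrite inE aS mem_arc_lt //; clear -va; lia.
have inL' a : res a \in S -> v < a < f v -> res a \in L.
  by move=> aS va; rewrite inL //; clear -va fvb; lia.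
have outL a : res a \in L -> exists q, v < a + q * n%:Z < f v.
  move=> aL; exists (- T a (v + 1)); have aS : res a \in S by move: aL; rewrite inE => /andP[].
  have := turns_bounds n_gt0 a (v + 1); set b := a + _ => ab.
  have bE : res b = res a by apply: resD.
  have bv : b <> v + n%:Z by apply: neS; rewrite ?bE ?resDn.
  have := @inL b; rewrite bE => /(_ aS); rewrite aL /b; clear -ab bv; lia.
have fL a : res a \in S -> v < a < f v ->
    v < f a < f v \/ v + n%:Z < f a < f v + n%:Z.
  move=> aS va; have fab := fb a.
  have faS : res (f a) \in S by rewrite res_stable.
  have n1 : f a <> f v by apply: neS.
  have n2 : f a <> v + n%:Z by apply: neS; rewrite ?resDn.
  have := NS v a; rewrite aS (negPf vS) => /(_ isT); rewrite /crosses.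
  by clear -va fab n1 n2 fvb; lia.
have Ls : stable s L.
  apply: stable_of_subset => x; rewrite -{1}(res_ord n_gt0 x) => /[dup] xL /outL[q].
  set a := _ + _ => va; have aE : res a = x by rewrite /a resD res_ord.
  have aS : res a \in S by rewrite aE; move: xL; rewrite res_ord inE => /andP[].
  have faS : res (f a) \in S by rewrite res_stable.
  rewrite -aE -fs.2; have [h|h] := fL a aS va; first exact: inL'.
  have faE : res (f a - n%:Z) = res (f a) by rewrite -(resDn n_gt0) subrK.
  by rewrite -faE; apply: inL'; rewrite ?faE //; clear -h; lia.
have LS a : res a \in L -> res a \in S by rewrite inE => /andP[].
have nLR x y : res x \in L -> res y \in S -> res y \notin L -> ~~ crosses x y && ~~ crosses y x.
  move=> xL; have [q] := outL x xL; rewrite -(crossesD x y q) -(crossesD y x q).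
  rewrite -(resD n_gt0 q y); move: (y + _) => {}y; rewrite -(resD n_gt0 q x) in xL.
  move: xL; move: (x + _) => {}x xL vx yS yL; have xS := LS x xL.
  have nfy : res (f y) \notin L by rewrite res_stable.
  have fyS : res (f y) \in S by rewrite res_stable.
  have notin a : res a \in S -> res a \notin L -> ~ v < a < f v.
    by move=> aS aL va; rewrite inL' in aL.
  have notin' a : res a \in S -> res a \notin L -> ~ v + n%:Z < a < f v + n%:Z.
    move=> aS aL va; have := @notin (a - n%:Z); rewrite -(resDn n_gt0 (a - _)) subrK.
    by move=> /(_ aS aL); clear -va; lia.
  have := notin y yS yL; have := notin' y yS yL.
  have := notin _ fyS nfy; have := notin' _ fyS nfy.
  have := fL x xS vx; rewrite /crosses; clear -vx fvb; lia.
split=> // x y.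
  case xL: (res x \in L); case yL: (res y \in L) => // _.
    have [yS|yS] := boolP (res y \in S); last by apply: NS; rewrite (LS x) // (negPf yS).
    by have /andP[] := nLR x y xL yS (negbT yL).
  have [xS|xS] := boolP (res x \in S); last by apply: NS; rewrite (LS y) // (negPf xS).
  by have /andP[] := nLR y x yL xS (negbT xL).
rewrite ![_ \in _ :\: _]inE; case xL: (res x \in L); case yL: (res y \in L) => //=.
- case yS: (res y \in S) => // _.
  by have /andP[] := nLR x y xL yS (negbT yL).
- case xS: (res x \in S) => // _.
  by have /andP[] := nLR y x yL xS (negbT xL).
- exact: NS.
Qed.

(* Induction on [#|S|]: a chord outside [S] with elements of [S] on both sides
   splits [S] into two smaller noncrossing stable sets; without such a chord, the
   gap of [S] around [j] is a stable arc. *)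
Lemma noncrossing_separated S i j : stable s S -> noncrossing S ->
  i \in S -> j \notin S -> separated s i j.
Proof.
have [m] := ubnP #|S|; elim: m S => // m IH S Sm Ss NS iS jS.
have [side|] := pselect (forall v, res v \notin S ->
     (forall u, res u \in S -> v < u < v + n%:Z -> u < f v) \/
     (forall u, res u \in S -> v < u < v + n%:Z -> f v < u)).
  exact: separated_gap side.
move=> /existsNP[v /not_implyP[vS /not_orP[]]].
move=> /existsNP[u /not_implyP[uS /not_implyP[vu ufv]]].
move=> /existsNP[u' /not_implyP[u'S /not_implyP[vu' u'fv]]].
have [Ls NL NR] := noncrossing_side Ss NS vS; set L := _ :&: _ in Ls NL NR.
have fvb := fb v; have v1 : v + 1 <= f v <= v + 1 + n%:Z by clear -fvb; lia.
have fvS : res (f v) \notin S by rewrite res_stable.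
have inL a : res a \in S -> v < a < v + n%:Z -> (res a \in L) = (a < f v).
  move=> aS va; rewrite inE aS mem_arc_lt //; clear -va; lia.
have u'L : res u' \in L.
  rewrite inL // lt_neqAle leNgt; apply/andP; split; last exact/negP.
  by apply/eqP => u'E; rewrite u'E (negPf fvS) in u'S.
have uL : res u \notin L by rewrite inL //; apply/negP.
have LS : L \subset S by apply: subsetIl.
have [iL|iL] := boolP (i \in L).
  apply: (IH L) => //; last by apply: contra jS; apply: subsetP.
  apply: leq_trans (proper_card _) (Sm : (#|S| <= m)%N).
  by apply/properP; split=> //; exists (res u).
apply: (IH (S :\: L)) => //; last 3 first.
- by move=> l; rewrite [LHS]in_setD [RHS]in_setD Ls Ss.
- by rewrite in_setD iL.
- by rewrite in_setD (negPf jS) andbF.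
apply: leq_trans (proper_card _) (Sm : (#|S| <= m)%N).
apply/properP; split; first exact: subsetDl.
by exists (res u') => //; rewrite in_setD u'L.
Qed.
End Noncrossing.

(** * Transport of separation under conjugation *)

Section Transfer.
Local Open Scope ring_scope.
Variables (n : nat) (n_gt0 : (0 < n)%N).
Variables (s t : 'S_n) (u v : int -> int).
Hypotheses (us : is_lift n_gt0 s u) (vt : is_lift n_gt0 t v).
Hypotheses (uv : coherent n u v) (vu : coherent n v u).
Hypotheses (uvb : bounded n (u \o v)) (vub : bounded n (v \o u)).

Let uvs := lift_comp us vt.
Let vus := lift_comp vt us.

Lemma card_preim_perm (V : {set 'I_n}) (r : 'S_n) : #|r @^-1: V| = #|V|.
Proof. by apply: card_preimset; apply: perm_inj. Qed.

Section Preimage.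
Variable V : {set 'I_n}.
Hypothesis Vs : stable (s \oS t) V.
Let A := s @^-1: V.

(** As [V] is stable, its preimage under [s] is its image under [t]; with [s = pi rho] and
    [t = rho^-1] this is [rho^-1 V]. *)
Lemma mem_preim_comp : mem A \o t =1 mem V.
Proof. by move=> i /=; have := Vs i; rewrite inE /perm_comp permM. Qed.

Lemma stable_preim : stable (t \oS s) A.
Proof. by move=> i; rewrite !inE /perm_comp permM; have := Vs (s i); rewrite /perm_comp permM. Qed.

Lemma disp_preim : disp (v \o u) (mem A) = disp (u \o v) (mem V).
Proof.
have := disp_comp (mem A) us vt; have := disp_comp (mem V) vt us.
rewrite /disp !(eq_bigl _ _ mem_preim_comp).
have E : mem V \o s =1 mem A by move=> i /=; rewrite inE.
by rewrite !(eq_bigl _ _ E) => -> ->; rewrite addrC.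
Qed.
End Preimage.

(** Both sides are the inversions of [v] between [V] and its complement plus those of [u] between
    the preimage and its complement. *)
Lemma inv_count_preim (V : {set 'I_n}) : stable (s \oS t) V ->
  inv_count (v \o u) (mem (s @^-1: V)) (mem (~: (s @^-1: V)))
  = inv_count (u \o v) (mem V) (mem (~: V)).
Proof.
move=> Vs; set A := _ @^-1: _.
have E2 : mem (~: A) \o t =1 mem (~: V).
  by move=> i /=; have := mem_preim_comp Vs i => /= e; rewrite !inE -e inE.
have E3 : mem V \o s =1 mem A by move=> i /=; rewrite inE.
have E4 : mem (~: V) \o s =1 mem (~: A) by move=> i /=; rewrite !inE.
have e1 : mem A \o t = mem V by apply: funext; apply: mem_preim_comp.
have e2 : mem (~: A) \o t = mem (~: V) by apply: funext.
have e3 : mem V \o s = mem A by apply: funext.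
have e4 : mem (~: V) \o s = mem (~: A) by apply: funext.
have := inv_countD (mem A) (mem (~: A)) us vt uv.
have := inv_countD (mem V) (mem (~: V)) vt us vu.
by rewrite e1 e2 e3 e4 => -> ->; rewrite addrC.
Qed.

Lemma separated_transfer x y :
  separated (s \oS t) x y -> separated (t \oS s) (t x) (t y).
Proof.
move=> [V Va xy]; have Vs : stable (s \oS t) V by case: Va => p [q []].
set A := s @^-1: V; have As : stable (t \oS s) A := stable_preim Vs.
have AC : ~: A = s @^-1: (~: V) by apply/setP => i; rewrite !inE.
have cnt W : stable_arc (s \oS t) W -> inv_count (v \o u) (mem (s @^-1: W)) (mem (~: (s @^-1: W)))
   = disp (v \o u) (mem (s @^-1: W)) *
     (#|~: (s @^-1: W)|%:Z - disp (v \o u) (mem (~: (s @^-1: W)))).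
  move=> Wa; have Ws : stable (s \oS t) W by case: Wa => p [q []].
  have WC : ~: (s @^-1: W) = s @^-1: (~: W) by apply/setP => i; rewrite !inE.
  rewrite inv_count_preim // (inv_count_arc uvs uvb Wa) WC !disp_preim //.
    by rewrite card_preim_perm.
  exact: stableC.
have NA : noncrossing n_gt0 (v \o u) A.
  move=> a b; case aA: (_ a \in A); case bA: (_ b \in A) => // _.
    by apply: (not_crosses_of_count vus vub As (cnt V Va)); rewrite ?bA.
  (* [crosses] is not symmetric, so the other order of the two chords needs the count for the
     complement. *)
  have := cnt _ (stable_arcC n_gt0 Va); rewrite -AC => cntC.
  by apply: (not_crosses_of_count vus vub (stableC As) cntC); rewrite inE ?aA ?bA.
have memA z : (t z \in A) = (z \in V) by have /= := mem_preim_comp Vs z.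
case xV: (x \in V); case yV: (y \in V) => //; move: xy; rewrite xV yV // => _.
  by apply: (noncrossing_separated vus vub As NA); rewrite memA ?xV ?yV.
by apply: separatedC; apply: (noncrossing_separated vus vub As NA); rewrite memA ?xV ?yV.
Qed.
End Transfer.

Lemma separated_conj n (n_gt0 : (0 < n)%N) (s t : 'S_n) u v x y :
  is_lift n_gt0 s u -> is_lift n_gt0 t v ->
  coherent n u v -> coherent n v u ->
  bounded n (u \o v) -> bounded n (v \o u) ->
  separated (t \oS s) (t x) (t y) <-> separated (s \oS t) x y.
Proof.
move=> us vt uv vu uvb vub; split; last exact: separated_transfer uvb vub x y.
move=> /(separated_transfer vt us vu uv vub uvb)[V Va xy].
exists V => //; have [p [q [_ _ Vs]]] := Va.
(* The transfer back ends at [s (t x)] and [s (t y)], which a stable set does not distinguish from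
   [x] and [y]. *)
by have := (Vs x, Vs y); rewrite /perm_comp !permM => -[<- <-].
Qed.

(** Expressed through [turns], the cyclic order is preserved by every map that preserves [turns]. *)
Lemma cyc_lt_turns n (n_gt0 : (0 < n)%N) (a x y : int) :
  cyc_lt (res n_gt0 a) (res n_gt0 x) (res n_gt0 y)
  = (turns n x y < turns n x a - turns n y a)%R.
Proof.
rewrite /cyc_lt; set i := res _ a; set j := res _ x; set l := res _ y.
have := cyc_posE n_gt0 j i; have := cyc_posE n_gt0 l i.
have := res_eq n_gt0 a; have := res_eq n_gt0 x; have := res_eq n_gt0 y.
rewrite -/i -/j -/l => -> -> ->.
move: (turns n x 0) (turns n y 0) (turns n a 0) => p q r jE lE.
rewrite !(turnsDl n_gt0) !(turnsDr n_gt0).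
transitivity (turns n j%:Z l%:Z < turns n j%:Z i%:Z - turns n l%:Z i%:Z)%R; last by clear; lia.
rewrite lt_turns //.
move: (turns n _ _) (turns n _ _) jE lE => A B jE lE.
by clear -jE lE; apply/idP/idP; lia.
Qed.

(** * Increasing enumerations of periodic sets *)

Section Embeddings.
Local Open Scope ring_scope.
Variables (n : nat) (n_gt0 : (0 < n)%N).
Implicit Types (a b x y q : int).

(** Increasing enumerations of [S + n Z] by [Z]. *)
Definition embedding m (S : {set 'I_n}) (phi : int -> int) : Prop :=
  [/\ forall x, phi (x + m%:Z) = phi x + n%:Z,
      {mono phi : x y / x <= y},
      forall x, res n_gt0 (phi x) \in S &
      forall a, res n_gt0 a \in S -> exists x, phi x = a].

Lemma enum_val_mono (S : {set 'I_n}) (i j : 'I_#|S|) :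
  (i < j)%N -> (enum_val i < enum_val j)%N.
Proof.
move=> ij; have srt : sorted ltn (map val (enum S)).
  apply: (subseq_sorted ltn_trans _ (iota_ltn_sorted 0 n)).
  by rewrite -val_enum_ord enumT; apply/map_subseq/filter_subseq.
have sz : size (map val (enum S)) = #|S| by rewrite size_map -cardE.
have := sorted_ltn_nth ltn_trans 0%N srt i j.
rewrite !inE !sz !ltn_ord => /(_ isT isT ij).
by rewrite !(nth_map (enum_val i)) -?cardE // -!enum_val_nth.
Qed.

Lemma embedding_exists (S : {set 'I_n}) : (0 < #|S|)%N ->
  exists phi, embedding #|S| S phi.
Proof.
move=> S_gt0; pose phi x := (enum_val (res S_gt0 x))%:Z + turns #|S| x 0 * n%:Z.
have phi_lt x y : x < y -> phi x < phi y.
  move=> xy; have := turns_homol S_gt0 0 (ltW xy); rewrite le_eqVlt => /orP[/eqP e|q].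
    rewrite /phi e ltrD2r ltz_nat; apply: enum_val_mono.
    have := res_eq S_gt0 x; have := res_eq S_gt0 y; rewrite e => yE xE.
    by rewrite -ltz_nat; clear -xy xE yE; lia.
  have := ltn_ord (enum_val (res S_gt0 x)); rewrite /phi.
  move: (turns _ x 0) (turns _ y 0) q => p q pq.
  by move: (nat_of_ord _) (nat_of_ord _) => i j ij; nia.
exists phi; split.
- by move=> x; rewrite /phi resDn turnsDnl // mulrDl mul1r addrA.
- exact: le_mono.
- by move=> x; rewrite /phi resD res_ord enum_valP.
- move=> a aS; exists ((enum_rank_in aS (res n_gt0 a))%:Z + turns n a 0 * #|S|%:Z).
  rewrite /phi resD res_ord enum_rankK_in // turnsDl // turns_ord // add0r.
  by rewrite -res_eq.
Qed.

Section Embedded.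
Variables (m : nat) (m_gt0 : (0 < m)%N) (S : {set 'I_n}) (phi : int -> int).
Hypothesis ph : embedding m S phi.

Lemma embeddingD x q : phi (x + q * m%:Z) = phi x + q * n%:Z.
Proof.
have [phD _ _ _] := ph.
pose F y := phi y - turns m y 0 * n%:Z.
have FD y : F (y + m%:Z) = F y by rewrite /F phD turnsDnl //; lia.
by have := periodic_turns FD x q; rewrite /F turnsDl //; lia.
Qed.

Lemma embedding_inj : injective phi.
Proof. by case: ph => _ mono _ _; apply: (inc_inj mono). Qed.

(** An increasing map carrying period [m] to period [n] preserves these floors. Coherence is stated
    with them alone, and so restricts to a component. *)
Lemma turns_embedding x y : turns n (phi x) (phi y) = turns m x y.
Proof.
apply: turnsP => //; case: ph => _ mono _ _.
rewrite -[_ + n%:Z](_ : phi (y + (turns m x y + 1) * m%:Z) = _); last first.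
  by rewrite embeddingD; lia.
rewrite -embeddingD mono (leW_mono mono).
by have := turns_bounds m_gt0 x y; lia.
Qed.

Lemma embedding_shift q : embedding m S (fun x => phi (x + q)).
Proof.
case: ph => phD mono phS phE; split=> [x|x y|x|a /phE[x <-]] //.
- by rewrite addrAC phD.
- by rewrite mono lerD2r.
- by exists (x - q); rewrite subrK.
Qed.

Lemma res_embedding x : res n_gt0 (phi (res m_gt0 x)%:Z) = res n_gt0 (phi x).
Proof. by rewrite [in RHS](res_eq m_gt0 x) embeddingD resD. Qed.

Lemma embedding_cyclic_bijection :
  cyclic_bijection S (fun i : 'I_m => res n_gt0 (phi i%:Z)).
Proof.
have [_ _ phS phE] := ph; split.
- move=> i j /eq_res; rewrite -embeddingD => /embedding_inj e.
  by rewrite -(res_ord m_gt0 i) -(res_ord m_gt0 j) e resD.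
- apply/setP => i; apply/imsetP/idP => [[j _ ->//]|iS].
  have [|x xE] := phE i%:Z; first by rewrite res_ord.
  by exists (res m_gt0 x); rewrite // res_embedding xE res_ord.
- move=> a x y; rewrite cyc_lt_turns !turns_embedding -(cyc_lt_turns m_gt0).
  by rewrite !res_ord.
Qed.
End Embedded.

Lemma is_lift_exists (u : int -> int) : (forall a, u (a + n%:Z) = u a + n%:Z) ->
  injective u -> exists t, is_lift n_gt0 t u.
Proof.
move=> uD uI; have FD a q : u (a + q * n%:Z) = u a + q * n%:Z.
  pose F b := u b - turns n b 0 * n%:Z.
  have FD b : F (b + n%:Z) = F b by rewrite /F uD turnsDnl //; lia.
  by have := periodic_turns FD a q; rewrite /F turnsDl //; lia.
have inj : injective (fun i : 'I_n => res n_gt0 (u i%:Z)).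
  move=> i j /eq_res; rewrite -FD => /uI e.
  by rewrite -(res_ord n_gt0 i) -(res_ord n_gt0 j) e resD.
exists (perm inj); split=> // a; rewrite permE.
by rewrite [in LHS](res_eq n_gt0 a) FD resD.
Qed.
End Embeddings.

(** * Restriction of lifts along enumerations *)

Section Compression.
Local Open Scope ring_scope.
Variables (n : nat) (n_gt0 : (0 < n)%N) (m : nat) (m_gt0 : (0 < m)%N).

Lemma compress_exists (s : 'S_n) (u : int -> int) (S A : {set 'I_n}) phi psi :
  is_lift n_gt0 s u -> embedding n_gt0 m S phi -> embedding n_gt0 m A psi ->
  (forall i, i \in S -> s i \in A) ->
  exists2 v, (forall x, psi (v x) = u (phi x)) & exists t, is_lift m_gt0 t v.
Proof.
move=> us ph ps SA; have [phD _ phS _] := ph; have [psD _ _ psE] := ps.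
have /choice[v vE] x : exists y, psi y = u (phi x).
  by apply: psE; rewrite us.2 SA.
exists v => //; apply: is_lift_exists => [a|a b ab].
  by apply: (embedding_inj ps); rewrite psD !vE phD us.1.
by apply: (embedding_inj ph); apply: (is_lift_inj us); rewrite -!vE ab.
Qed.

Lemma induced_perm_compress (s : 'S_n) (t : 'S_m) u v (S A : {set 'I_n}) phi psi :
  is_lift n_gt0 s u -> embedding n_gt0 m S phi -> embedding n_gt0 m A psi ->
  is_lift m_gt0 t v -> (forall x, psi (v x) = u (phi x)) ->
  induced_perm (fun i : 'I_m => res n_gt0 (phi i%:Z)) (fun i : 'I_m => res n_gt0 (psi i%:Z)) s t.
Proof.
move=> us ph ps vt vE i; rewrite -[in LHS](res_ord m_gt0 i) -vt.2.
by rewrite (res_embedding _ ps) vE us.2.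
Qed.

(** The floors do not shift termwise, but the average displacement does. *)
Lemma disp_subr (u : int -> int) (q : int) : (forall a, u (a + n%:Z) = u a + n%:Z) ->
  injective u -> disp (fun a => u a - q) (predT : pred 'I_n) = disp u (predT : pred 'I_n) - q.
Proof.
move=> uD uI; have [t ut] := is_lift_exists n_gt0 uD uI.
have wD a : u (a + n%:Z) - q = u a - q + n%:Z by rewrite uD addrAC.
have [t' wt] := is_lift_exists n_gt0 wD (fun a b => fun e => uI _ _ (addIr _ e)).
apply: (intr_inj (R := rat)); rewrite -(avg_displacementE wt) rmorphB /= -(avg_displacementE ut).
rewrite /avg_displacement -[q%:~R](@mulfK _ (n%:R)) ?pnatr_eq0 -?lt0n // -mulrBl.
congr (_ / _); rewrite -[n%:R]/(n%:Z%:~R) -intrM -rmorphB /=; congr _%:~R.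
rewrite (eq_bigr (fun a : nat => u a%:Z - a%:Z - q)); last by move=> a _; rewrite addrAC.
by rewrite sumrB sumr_const_nat subSS subn0 -mulr_natr natz.
Qed.
End Compression.

Section CompressedLifts.
Local Open Scope ring_scope.
Variables (n : nat) (n_gt0 : (0 < n)%N) (m : nat) (m_gt0 : (0 < m)%N).
Variables (S A : {set 'I_n}) (phi psi : int -> int).
Hypotheses (ph : embedding n_gt0 m S phi) (ps : embedding n_gt0 m A psi).

Lemma coherent_compress u v u' v' : (forall x, phi (u' x) = u (psi x)) ->
  (forall x, psi (v' x) = v (phi x)) -> coherent n u v -> coherent m u' v'.
Proof.
move=> uE vE uv a b; rewrite -(turns_embedding m_gt0 ps (v' a) (v' b)).
by rewrite -(turns_embedding m_gt0 ph a b) -(turns_embedding m_gt0 ph (u' _)) !uE !vE; apply: uv.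
Qed.

Lemma bounded_compress w w' : (forall x, phi (w' x) = w (phi x)) ->
  bounded n w -> bounded m w'.
Proof.
move=> wE wb a; have := wb (phi a); case: ph => phD mono _ _.
by rewrite -wE -phD mono (leW_mono mono).
Qed.
End CompressedLifts.

(** * Admissibility as coherence of two lifts *)

Section Admissibility.
Local Open Scope ring_scope.
Variables (n : nat) (n_gt0 : (0 < n)%N).

Lemma lift_inv_lift (s : 'S_n) : is_lift n_gt0 s^-1%g (lift_inv s).
Proof.
split=> b; last first.
  by have := residue_lift_inv s (residueE n_gt0 b); rewrite (residueE n_gt0) => -[].
by rewrite /lift_inv residueD; case: (residue n b) => // i; rewrite addrAC.
Qed.

Lemma perm_compA (r s t : 'S_n) : r \oS (s \oS t) = r \oS s \oS t.
Proof. by rewrite /perm_comp mulgA. Qed.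

Lemma perm_compVK (s t : 'S_n) : s \oS t \oS t^-1%g = s.
Proof. by rewrite /perm_comp mulKg. Qed.

Lemma has_typeE (k : nat) (s : 'S_n) :
  has_type k s <-> disp (lift_fun s) (predT : pred 'I_n) = k%:Z.
Proof.
rewrite /has_type (avg_displacementE (lift_fun_lift n_gt0 s)).
by split=> [e|->//]; apply: (intr_inj (R := rat)); rewrite e.
Qed.

Lemma eq_lift_fun (s : 'S_n) u : is_lift n_gt0 s u -> bounded n u -> u = lift_fun s.
Proof. by move=> us ub; apply: funext; apply: bounded_uniq us ub. Qed.

Lemma disp_compT (s t : 'S_n) u v : is_lift n_gt0 s u -> is_lift n_gt0 t v ->
  disp (u \o v) (predT : pred 'I_n)
  = disp v (predT : pred 'I_n) + disp u (predT : pred 'I_n).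
Proof. by move=> us vt; have /= := disp_comp (predT : pred 'I_n) us vt. Qed.

Lemma admissible_lifts k (pi rho : 'S_n) : admissible k pi rho ->
  exists u v, [/\ is_lift n_gt0 (pi \oS rho) u, is_lift n_gt0 rho^-1%g v,
    disp v (predT : pred 'I_n) = 0,
    coherent n u v /\ coherent n v u & bounded n (u \o v) /\ bounded n (v \o u)].
Proof.
move=> [/has_typeE tf /has_typeE tu [_ len] dim].
set u := lift_fun (pi \oS rho) in tu len; pose v := lift_inv (pi \oS rho) \o lift_fun pi.
have us : is_lift n_gt0 (pi \oS rho) u := lift_fun_lift n_gt0 _.
have vt : is_lift n_gt0 rho^-1%g v.
  rewrite (_ : rho^-1%g = (pi \oS rho)^-1%g \oS pi); last first.
    by rewrite /perm_comp invMg mulgA mulgV mul1g.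
  exact: lift_comp (lift_inv_lift _) (lift_fun_lift _ _).
have uvE : u \o v = lift_fun pi by apply: funext => x /=; rewrite /v /u /= lift_invK.
have uv : coherent n u v.
  by apply/(aff_length_coherent us vt); rewrite uvE -[RHS]len.
have fb : bounded n (u \o v) by rewrite uvE; apply: lift_fun_bounded.
have v0 : disp v (predT : pred 'I_n) = 0.
  by apply: (@addIr _ k%:Z); rewrite add0r -{1}tu -(disp_compT us vt) uvE.
have vub : bounded n (v \o u).
  move=> a; have uD x : (u \o v) (x + n%:Z) = (u \o v) x + n%:Z.
    by rewrite uvE lift_funD.
  have [b <-] : exists b, v b = a.
    exists (lift_inv pi (u a)); rewrite /v /= lift_invK.
    by apply: (is_lift_inj us); rewrite /u lift_invK.
  exact: bounded_conj vt uv fb uD b.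
exists u, v; split=> //; split=> //.
apply/(aff_length_coherent vt us).
(* A bounded lift is unique, so [v \o u] is the one whose length enters the dimension condition. *)
have -> : v \o u = lift_fun (rho^-1%g \oS pi \oS rho).
  by apply: eq_lift_fun vub; rewrite -perm_compA; apply: lift_comp.
move/eqP: dim; rewrite /cone_dim (inj_eq (addrI _)) eqr_opp eqz_nat => /eqP -> /=.
by rewrite addnC; exact: len.
Qed.

(** Displacement 0 of [v] gives [s] and [s \oS t] the same type and, by [bounded_factor], makes [u]
    the bounded lift of [s]. The two coherences yield the two length conditions. *)
Lemma admissible_of_lifts (s t : 'S_n) u v :
  is_lift n_gt0 s u -> is_lift n_gt0 t v -> disp v (predT : pred 'I_n) = 0 ->
  coherent n u v -> coherent n v u -> bounded n (u \o v) ->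
  exists k : nat, admissible k (s \oS t) t^-1%g.
Proof.
move=> us vt v0 uv vu fb; have uvs := lift_comp us vt; have vus := lift_comp vt us.
have fE := eq_lift_fun uvs fb.
have uD x : (u \o v) (x + n%:Z) = (u \o v) x + n%:Z by case: uvs.
have vsurj a : exists b, v b = a.
  pose w := lift_inv t; have [wD wE] := lift_inv_lift t.
  have e : res n_gt0 (v (w a)) = res n_gt0 a by rewrite vt.2 wE permKV.
  exists (w a + turns n a (v (w a)) * n%:Z).
  by rewrite (is_liftD vt) -(eq_res e).
have ub : bounded n u by move=> a; have [b <-] := vsurj a; apply: bounded_factor vt uv v0 fb b.
have vub : bounded n (v \o u).
  by move=> a; have [b <-] := vsurj a; apply: bounded_conj vt uv fb uD b.
have uE := eq_lift_fun us ub; have vuE := eq_lift_fun vus vub.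
pose d := disp u (predT : pred 'I_n).
have dE : disp (u \o v) (predT : pred 'I_n) = d.
  by rewrite (disp_compT us vt) v0 add0r.
have d_ge0 : 0 <= d.
  apply: sumr_ge0 => i _; rewrite subr_ge0; apply: turns_homol => //.
  by have := ub i%:Z; lia.
have kE : d = `|d|%N%:Z by rewrite gez0_abs.
exists `|d|%N; split.
- by apply/has_typeE; rewrite -fE dE.
- by rewrite perm_compVK; apply/has_typeE; rewrite -uE.
- rewrite perm_compVK; split.
    rewrite (avg_displacementE (lift_fun_lift n_gt0 s)) (avg_displacementE (lift_fun_lift n_gt0 _)).
    by rewrite -fE -uE dE.
  rewrite /= -fE -[X in (aff_length n X + _)%N]uE (_ : lift_inv s \o (u \o v) = v).
    exact/(aff_length_coherent us vt).
  by apply: funext => x /=; rewrite uE lift_funK.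
- rewrite invgK /cone_dim perm_compA perm_compVK /= -fE -vuE; congr (_ - _%:Z).
  have := (aff_length_coherent us vt).2 uv; have := (aff_length_coherent vt us).2 vu.
  by move=> -> ->; rewrite addnC.
Qed.
End Admissibility.

(** * Components of the conjugate and the induced permutations *)

Section ConjugateComponents.
Variables (n : nat) (n_gt0 : (0 < n)%N).

(** A stable arc never separates [x] from [s x]. *)
Lemma component_stable k (s : 'S_n) (I : finType) (S : I -> {set 'I_n}) (i : I) :
  has_type k s -> component_ground_sets (positroid k s) S -> stable s (S i).
Proof.
move=> /(has_typeE n_gt0) sk.
have sl := lift_fun_lift n_gt0 s; have sb := lift_fun_bounded n_gt0 s.
case/(component_separated sl sb sk) => S0 disj SE sep.
apply: stable_of_subset => x xi; have : s x \in [set: 'I_n] by rewrite inE.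
rewrite -SE => /bigcupP[j _ sxj]; suff -> : i = j by [].
have [ij|/eqP ij] := eqVneq i j; first by [].
have [V [p [q [_ _ Vs]]]] := (sep i j x (s x) xi sxj).2 ij.
by rewrite Vs eqxx.
Qed.

(** The label is a fixed point, so it lies in its own necklace, and all bases meet a summand in the
    same number of elements. *)
Lemma coloop_component k (s : 'S_n) (I : finType) (S : I -> {set 'I_n}) (i : I) x :
  has_type k s -> component_ground_sets (positroid k s) S -> S i = [set x] ->
  coloop (positroid k s) x.
Proof.
move=> sk cS Six; have sx : s x = x.
  by have := component_stable i sk cS x; rewrite Six !inE eqxx => /eqP.
move: sk => /(has_typeE n_gt0) sk J JM.
have sl := lift_fun_lift n_gt0 s; have sb := lift_fun_bounded n_gt0 s.
have xN : x \in necklace s x by rewrite inE (_ : s^-1%g x = x) ?/cyc_le // -{1}sx permK.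
have NM := necklace_positroid sl sb sk x; have [BB dsum _] := cS.
have := direct_sum_card dsum i (@positroid_card n s k) JM NM.
rewrite Six => e; apply: contraT => xJ.
have : x \in necklace s x :&: [set x] by rewrite in_setI xN set11.
suff -> : necklace s x :&: [set x] = finset.set0 by rewrite inE.
apply/eqP; rewrite -cards_eq0 -e cards_eq0; apply/eqP/setP => y.
by rewrite !inE; case: eqP => [->|]; rewrite ?andbF // (negPf xJ).
Qed.

Lemma component_conj k (s t : 'S_n) u v (I : finType) (S : I -> {set 'I_n}) :
  is_lift n_gt0 s u -> is_lift n_gt0 t v ->
  coherent n u v -> coherent n v u ->
  bounded n (u \o v) -> bounded n (v \o u) ->
  has_type k (s \oS t) -> component_ground_sets (positroid k (s \oS t)) S ->
  has_type k (t \oS s) /\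
  component_ground_sets (positroid k (t \oS s)) (fun i => (t^-1)%g @^-1: S i).
Proof.
move=> us vt uv vu uvb vub st cS.
have uvs := lift_comp us vt; have vus := lift_comp vt us.
have tk : disp (u \o v) (predT : pred 'I_n) = k.
  by rewrite (eq_lift_fun uvs uvb); apply/(has_typeE n_gt0).
have tk' : disp (v \o u) (predT : pred 'I_n) = k.
  by rewrite (disp_compT vt us) GRing.addrC -(disp_compT us vt).
split; first by apply/(has_typeE n_gt0); rewrite -(eq_lift_fun vus vub).
move/(component_separated uvs uvb tk): cS => [S0 disj SE sep].
apply/(component_separated vus vub tk'); split.
- by move=> i; have /set0Pn[x xi] := S0 i; apply/set0Pn; exists (t x); rewrite inE permK.
- move=> i j ij; rewrite -setI_eq0 -preimsetI.
  by have := disj i j ij; rewrite -setI_eq0 => /eqP ->; rewrite preimset0.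
- apply/setP => x; rewrite inE; have : (t^-1)%g x \in [set: 'I_n] by rewrite inE.
  by rewrite -SE => /bigcupP[i _ xi]; apply/bigcupP; exists i; rewrite ?inE.
- move=> i j x y; rewrite !inE => xi yj; rewrite -(sep i j _ _ xi yj).
  by have := separated_conj (t^-1%g x) (t^-1%g y) us vt uv vu uvb vub; rewrite !permKV.
Qed.

(** An enumeration is determined only up to a shift, and the relative shift of the two matters: it
    changes [rho_j] by a rotation. *)
Lemma component_relabel (s t : 'S_n) u v (S : {set 'I_n}) m : (0 < m)%N -> m = #|S| ->
  is_lift n_gt0 s u -> is_lift n_gt0 t v ->
  coherent n u v -> coherent n v u -> bounded n (u \o v) ->
  stable (s \oS t) S ->
  exists (al be : 'I_m -> 'I_n) (s' t' : 'S_m),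
    [/\ cyclic_bijection ((t^-1)%g @^-1: S) al /\ cyclic_bijection S be,
        induced_perm al be s s', induced_perm be al t t' &
        exists k : nat, admissible k (s' \oS t') (t'^-1)%g].
Proof.
move=> m_gt0 mS us vt uv vu uvb Ss; set A := _ @^-1: S.
have mA : m = #|A| by rewrite card_preim_perm.
have [phi ph] : exists phi, embedding n_gt0 m S phi.
  by rewrite mS; apply: embedding_exists; rewrite -mS.
have [psi0 ps0] : exists psi, embedding n_gt0 m A psi.
  by rewrite mA; apply: embedding_exists; rewrite -mA.
have tS i : i \in S -> t i \in A by rewrite inE permK.
have sA i : i \in A -> s i \in S.
  by rewrite inE => iS; have := Ss (t^-1%g i); rewrite /perm_comp permM permKV iS.
have [v0 v0E [t0 v0t]] := compress_exists m_gt0 vt ph ps0 tS.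
(* The enumeration of [A + n Z] is chosen so that [v'] has displacement 0. *)
pose q := disp v0 (predT : pred 'I_m); pose psi x := psi0 (x + q)%R.
have ps : embedding n_gt0 m A psi := embedding_shift ps0 q.
pose v' x := (v0 x - q)%R.
have v'E x : psi (v' x) = v (phi x) by rewrite /psi /v' GRing.subrK.
have [t' vt'] : exists t', is_lift m_gt0 t' v'.
  apply: is_lift_exists => [a|a b /GRing.addIr /(is_lift_inj v0t)//].
  by rewrite /v' v0t.1 GRing.addrAC.
have v'0 : disp v' (predT : pred 'I_m) = 0%R.
  by rewrite /v' (disp_subr m_gt0 _ v0t.1 (is_lift_inj v0t)) GRing.subrr.
have [u' u'E [s' us']] := compress_exists m_gt0 us ps ph sA.
exists (fun i => res n_gt0 (psi i%:Z%R)), (fun i => res n_gt0 (phi i%:Z%R)), s', t'; split.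
- by split; apply: embedding_cyclic_bijection.
- exact: induced_perm_compress us ps ph us' u'E.
- exact: induced_perm_compress vt ph ps vt' v'E.
- apply: (admissible_of_lifts us' vt' v'0).
  + exact: (coherent_compress m_gt0 ph ps).
  + exact: (coherent_compress m_gt0 ps ph).
  + by apply: (bounded_compress ph) uvb => x /=; rewrite u'E v'E.
Qed.

End ConjugateComponents.

Theorem lemma4p32 (n k c : nat) (pi rho : 'S_n) (S : 'I_c -> {set 'I_n})
  (n_gt0 : (0 < n)%N)
  (pi_type : has_type k pi)
  (S_components : component_ground_sets (positroid k pi) S)
  (rho_admissible : admissible k pi rho) :
  let mu : 'S_n := rho^-1%g \oS pi \oS rho in
  let A : 'I_c -> {set 'I_n} := fun j => rho @^-1: S j in
  component_ground_sets (positroid k mu) A /\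
  forall j : 'I_c,
    exists (al be : 'I_#|S j| -> 'I_n) (mu_j pi_j rho_j : 'S_#|S j|),
      [/\ cyclic_bijection (A j) al /\ cyclic_bijection (S j) be,
          [/\ induced_perm al al mu mu_j,
              induced_perm be be pi pi_j &
              induced_perm al be rho rho_j],
          pi_j = rho_j \oS mu_j \oS rho_j^-1%g,
          (1 < #|S j|)%N -> exists k_j : nat, admissible k_j pi_j rho_j &
          #|S j| = 1%N ->
            [/\ mu_j = 1%g, pi_j = 1%g, rho_j = 1%g,
                exists2 x, A j = [set x] & coloop (positroid k mu) x &
                exists2 x, S j = [set x] & coloop (positroid k pi) x]].
Proof.
move=> mu A; have [u [v [us vt _ [uv vu] [uvb vub]]]] := admissible_lifts n_gt0 rho_admissible.
have stE : (pi \oS rho) \oS rho^-1%g = pi by apply: perm_compVK.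
have tsE : rho^-1%g \oS (pi \oS rho) = mu by apply: perm_compA.
have := component_conj us vt uv vu uvb vub (S := S).
rewrite stE tsE invgK => /(_ k pi_type S_components)[mu_type A_components].
split=> // j; have Ss := component_stable n_gt0 j pi_type S_components.
have S_gt0 : (0 < #|S j|)%N.
  by case: S_components => BB [/(_ j) S0 _ _ _ _] _; rewrite card_gt0.
have := component_relabel S_gt0 erefl us vt uv vu uvb; rewrite stE invgK => /(_ Ss).
move=> [al [be [s [t [[alA beS] sE tE adm]]]]].
(* [s] and [t] restrict [pi rho] and [rho^-1], whose products in the two orders are [pi] and
   [mu]. *)
exists al, be, (t \oS s), (s \oS t), t^-1%g; split=> //.
- split=> i.
  + by rewrite -tsE /perm_comp !permM tE sE permM.
  + by rewrite -stE /perm_comp !permM sE tE !permM.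
  + by apply: (@perm_inj _ rho^-1%g); rewrite permK -tE permKV.
- by rewrite invgK /perm_comp !mulgA mulgK.
- move=> S1; have perm1 (r : 'S_#|S j|) : r = 1%g.
    apply/permP => i; apply: val_inj; rewrite permE /=.
    have rlt := ltn_ord (r i); have ilt := ltn_ord i.
    have := leq_trans rlt (eq_leq S1); have := leq_trans ilt (eq_leq S1).
    by rewrite !ltnS !leqn0 => /eqP -> /eqP ->.
  split; try exact: perm1.
    have /eqP/cards1P[x Ax] : #|A j| = 1%N by rewrite card_preim_perm.
    by exists x => //; apply: (coloop_component (i := j) n_gt0 mu_type A_components Ax).
  have /cards1P[x Sx] := introT eqP S1.
  by exists x => //; apply: (coloop_component (i := j) n_gt0 pi_type S_components Sx).
Qed.
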